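(* Let $\mu$ be a positive finite Borel measure on $[0,1)$ and $\gamma>0$. The following are equivalent: (i) $I_\mu: H^\infty_{v_\gamma}\to H(\mathbb{D})$ is well defined (equivalently, well defined and continuous); (ii) $\int_0^1\frac{d\mu(t)}{(1-t)^\gamma}<\infty$; (iii) $\sum_{n=1}^\infty \mu_n n^{\gamma-1}<\infty$; (iv) $I_\mu: H^\infty_{v_\gamma}\to H^\infty_{v_1}$ is a compact operator; equivalently, $I_\mu: H^\infty_{v_\gamma}\to H^\infty_{v_{\gamma+\delta}}$ is compact for every real $\delta$ with $\gamma+\delta\ge1$; (v) $I_\mu: H^\infty_{v_\gamma}\to H^\infty_{v_1}$ is well defined; equivalently, $I_\mu: H^\infty_{v_\gamma}\to H^\infty_{v_{\gamma+\delta}}$ is well defined for every $\delta$ with $\gamma+\delta\ge1$. In particular, $I_\mu:H^\infty_{v_1}\to H^\infty_{v_1}$ is well defined if and only if it is compact, if and only if $\sum_n\mu_n<\infty$. If (i)–(v) hold, then $I_\mu: H^0_{v_\gamma}\to H^0_{v_1}$ is a compact operator (equivalently $I_\mu: H^0_{v_\gamma}\to H^0_{v_{\gamma+\delta}}$ is compact for every $\delta$ with $\gamma+\delta\ge1$), and $I_\mu(H^\infty_{v_\gamma})\subseteq H^0_{v_1}$.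
   Context: $\mathbb{D}$ is the open unit disc and $H(\mathbb{D})$ the space of holomorphic functions on $\mathbb{D}$ with the topology of uniform convergence on compact subsets. For a positive finite Borel measure $\mu$ on $[0,1)$, $\mu_n=\int_0^1 t^n\,d\mu(t)$ are its moments, and $I_\mu(f)(z)=\int_0^1\frac{f(t)}{1-tz}\,d\mu(t)$ for $f\in H(\mathbb{D})$ whenever this defines a holomorphic function on $\mathbb{D}$. For $\gamma>0$, $v_\gamma(z)=(1-|z|)^\gamma$; $H^\infty_{v}=\{f\in H(\mathbb{D}):\|f\|_v:=\sup_{z\in\mathbb{D}}v(z)|f(z)|<\infty\}$ and $H^0_v=\{f\in H^\infty_v:\lim_{|z|\to1^-}v(z)|f(z)|=0\}$, Banach spaces with norm $\|\cdot\|_v$. *)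

(* Defs.v *)
From HB Require Import structures.
From mathcomp Require Import all_boot all_order all_algebra.
From mathcomp Require Import complex.
From mathcomp Require Import all_classical all_reals all_analysis.
Import Order.TTheory GRing.Theory Num.Theory numFieldNormedType.Exports.
Set Implicit Arguments. Unset Strict Implicit. Unset Printing Implicit Defensive.
Local Open Scope ring_scope.
Local Open Scope classical_set_scope.
Local Open Scope complex_scope.

Section Defs.
Variable R : realType.
Local Notation C := R[i].

Definition modc (z : C) : R := ComplexField.Normc.normc z.

Definition disc : set C := [set z | modc z < 1].

(* holomorphic on the disc: complex differentiable at every point of D
   (R[i]^o is R[i] seen as a normed space over the field R[i]) *)
Definition holo (f : C -> C) : Prop :=
  forall z, disc z -> derivable (f : C^o -> C^o) z 1.

Definition wgt (gamma : R) (z : C) : R := (1 - modc z) `^ gamma.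

Definition wnorm (v : C -> R) (f : C -> C) : \bar R :=
  ereal_sup [set ((v z * modc (f z))%:E) | z in disc].

Definition Hinf (v : C -> R) (f : C -> C) : Prop :=
  holo f /\ (wnorm v f < +oo)%E.

Definition H0 (v : C -> R) (f : C -> C) : Prop :=
  Hinf v f /\
  forall eps : R, 0 < eps -> exists r : R, r < 1 /\
    forall z, r < modc z -> modc z < 1 -> v z * modc (f z) < eps.

Definition moment (mu : {finite_measure set R -> \bar R}) (n : nat) : R :=
  fine (\int[mu]_(t in `[0%R, 1%R[) (t ^+ n)%:E)%E.

Definition Ikernel (f : C -> C) (z : C) (t : R) : C :=
  f t%:C / (1 - t%:C * z).

Definition Imu (mu : {finite_measure set R -> \bar R}) (f : C -> C) (z : C) : C :=
  (fine (\int[mu]_(t in `[0%R, 1%R[) (complex.Re (Ikernel f z t))%:E)%E) +i*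
  (fine (\int[mu]_(t in `[0%R, 1%R[) (complex.Im (Ikernel f z t))%:E)%E).

Definition Imu_def (mu : {finite_measure set R -> \bar R}) (f : C -> C) : Prop :=
  (forall z, disc z ->
     mu.-integrable `[0%R, 1%R[ (fun t => (complex.Re (Ikernel f z t))%:E) /\
     mu.-integrable `[0%R, 1%R[ (fun t => (complex.Im (Ikernel f z t))%:E)) /\
  holo (Imu mu f).

Definition Imu_maps (mu : {finite_measure set R -> \bar R})
  (X Y : (C -> C) -> Prop) : Prop :=
  forall f, X f -> Imu_def mu f /\ Y (Imu mu f).

(* I_mu : X -> H(D) well defined and continuous, X normed by ||.||_v,
   H(D) with the topology of uniform convergence on compact subsets *)
Definition Imu_cont_HD (mu : {finite_measure set R -> \bar R})
  (X : (C -> C) -> Prop) (v : C -> R) : Prop :=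
  Imu_maps mu X (fun _ => True) /\
  forall f, X f -> forall K : set C^o, compact K -> K `<=` disc ->
  forall eps : R, 0 < eps -> exists delta : R, 0 < delta /\
    forall g, X g -> (wnorm v (fun x => (g x - f x)%R) < delta%:E)%E ->
      forall z, K z -> modc (Imu mu g z - Imu mu f z) < eps.

Definition Imu_compact (mu : {finite_measure set R -> \bar R})
  (X : (C -> C) -> Prop) (v : C -> R) (Y : (C -> C) -> Prop) (w : C -> R) : Prop :=
  Imu_maps mu X Y /\
  forall fs : nat -> C -> C, (forall k, X (fs k) /\ (wnorm v (fs k) <= 1)%E) ->
  exists (phi : nat -> nat) (g : C -> C),
    {homo phi : m n / (m < n)%N >-> (m < n)%N} /\ Y g /\
    forall eps : R, 0 < eps -> exists N : nat, forall k, (N <= k)%N ->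
      (wnorm w (fun x => (Imu mu (fs (phi k)) x - g x)%R) <= eps%:E)%E.

End Defs.

(* Main.v *)
(* The transform only sees f on [0,1), where |f(t)| <= ||f|| (1-t)^(-gamma).
   Under (ii) this makes (1-t)^gamma f(t) a bounded multiplier of the finite
   measure (1-t)^(-gamma) dmu, and compactness needs no normal-family argument:
   - inside a smaller disc, I_mu(f)(z) = sum_n a_n z^n with a_n the integral of
     t^n f(t), uniformly bounded over the unit ball, so a diagonal subsequence
     making every a_n converge makes I_mu(f_k) converge uniformly there;
   - near the circle, (1-|z|) |I_mu(f)(z)| is at most a constant times the
     integral of (1-t)^(-gamma) (1-r)/(1-tr), r = |z|, which tends to 0 by
     dominated convergence, uniformly over the unit ball.
   The converse is tested on f(z) = 1 + sum_(n >= 1) n^(gamma-1) z^n, whose values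
   on [0,1) are comparable to (1-t)^(-gamma); integrating the same comparison term
   by term gives (ii) <=> (iii). *)
Require Import Defs.
From HB Require Import structures.
From mathcomp Require Import all_boot all_order all_algebra.
From mathcomp Require Import complex ring lra zify.
From mathcomp Require Import all_classical all_reals all_analysis measurable_realfun.
Import Order.TTheory GRing.Theory Num.Theory numFieldNormedType.Exports.
Local Open Scope ring_scope.
Local Open Scope classical_set_scope.

(** Condition (i) is used only at the point z = 0, where the kernel is 1 and integrability of f on
    [0,1) is all that is asked; this is why a single test function recovers (ii). Every target with
    exponent a >= 1 reduces to exponent 1, because 1 - |z| lies in (0,1] on the disc. The limit of
    I_mu(f_k) is never identified as the transform of some function. It is shown to belong to the
    target because its holomorphy and its decay at the circle follow from estimates that are uniform
    over the unit ball and survive pointwise limits. For holomorphy the estimate is a second-order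
    remainder K |h|^2, which serves alike for power series, for the transform and for limits of
    transforms. *)

(** * The real-valued modulus and its link with the topology of [C^o] *)

Section Modulus.
Local Open Scope complex_scope.
Set Implicit Arguments. Unset Strict Implicit. Unset Printing Implicit Defensive.
Variable R : realType.
Local Notation C := R[i].
Implicit Types (z w h : C).

Lemma modc_ge0 z : 0 <= modc z.
Proof. by case: z => a b; exact: sqrtr_ge0. Qed.

Lemma modc_real (x : R) : modc x%:C = `|x|.
Proof. by rewrite /modc /= expr0n /= addr0 sqrtr_sqr. Qed.

Lemma modcE z : `|z| = (modc z)%:C.
Proof. by rewrite normc_def; case: z. Qed.

Lemma modc0 : modc (0 : C) = 0.
Proof. exact: ComplexField.Normc.normc0. Qed.

Lemma modc1 : modc (1 : C) = 1.
Proof. exact: ComplexField.Normc.normc1. Qed.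

Lemma modcM z w : modc (z * w) = modc z * modc w.
Proof. exact: ComplexField.Normc.normcM. Qed.

Lemma modcV z : modc z^-1 = (modc z)^-1.
Proof. exact: ComplexField.Normc.normcV. Qed.

Lemma modcX z n : modc (z ^+ n) = modc z ^+ n.
Proof.
elim: n => [|n IH]; first by rewrite !expr0 modc1.
by rewrite !exprS modcM IH.
Qed.

Lemma modcN z : modc (- z) = modc z.
Proof. exact: normcN. Qed.

Lemma modcD z w : modc (z + w) <= modc z + modc w.
Proof. exact: le_normcD. Qed.

Lemma modcB z w : modc (z - w) <= modc z + modc w.
Proof. by rewrite -(modcN w); exact: modcD. Qed.

Lemma modc_distrC z w : modc (z - w) = modc (w - z).
Proof. by rewrite -modcN opprB. Qed.

Lemma modc_triangle w z z' : modc (z - z') <= modc (z - w) + modc (w - z').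
Proof. by rewrite (le_trans _ (modcD _ _))// addrA subrK. Qed.

Lemma modc_reverse z w : modc z - modc w <= modc (z - w).
Proof. by rewrite lerBlDr (le_trans _ (modcD _ _))// subrK. Qed.

Lemma modc_eq0 z : (modc z == 0) = (z == 0).
Proof.
by apply/eqP/eqP => [|->]; [exact: ComplexField.Normc.eq0_normc|exact: modc0].
Qed.

Lemma modc_gt0 z : (0 < modc z) = (z != 0).
Proof. by rewrite lt_def modc_ge0 andbT modc_eq0. Qed.

Lemma Re_le_modc z : `|complex.Re z| <= modc z.
Proof.
by case: z => a b /=; rewrite -sqrtr_sqr ler_wsqrtr// lerDl sqr_ge0.
Qed.

Lemma Im_le_modc z : `|complex.Im z| <= modc z.
Proof.
by case: z => a b /=; rewrite -sqrtr_sqr ler_wsqrtr// lerDr sqr_ge0.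
Qed.

Lemma modc_le_ReIm z : modc z <= `|complex.Re z| + `|complex.Im z|.
Proof.
case: z => a b; have -> : (a +i* b) = a%:C + (0 +i* b) by simpc.
rewrite (le_trans (modcD _ _))// modc_real /= addr0 lerD //.
by rewrite expr0n /= !add0r sqrtr_sqr.
Qed.

Lemma ReB z w : complex.Re (z - w) = complex.Re z - complex.Re w.
Proof. by case: z w => [? ?] [? ?]. Qed.

Lemma ImB z w : complex.Im (z - w) = complex.Im z - complex.Im w.
Proof. by case: z w => [? ?] [? ?]. Qed.

Lemma modc_sum (I : Type) (r : seq I) (P : pred I) (F : I -> C) :
  modc (\sum_(i <- r | P i) F i) <= \sum_(i <- r | P i) modc (F i).
Proof.
elim/big_ind2 : _ => [|x a y b xa yb|//]; first by rewrite modc0.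
by rewrite (le_trans (modcD _ _))// lerD.
Qed.

(** The norm of [C^o] takes values in [C], so radii of balls are complex numbers; a positive one has
    zero imaginary part, and a real radius can replace it. *)
Lemma nbhs_modc z (A : set C^o) :
  nbhs (z : C^o) A <-> exists2 e : R, 0 < e & forall w, modc (w - z) < e -> A w.
Proof.
split=> [/nbhs_ballP[e /= e0 eA]|[e e0 eA]].
  case: e e0 eA => a b; rewrite ltcE /= => /andP[/eqP -> a0] eA.
  exists a => // w wz; apply: eA; rewrite /ball/= distrC modcE.
  by rewrite ltcR.
apply/nbhs_ballP; exists e%:C; first by rewrite /= ltcR.
by move=> w; rewrite /ball /= distrC modcE ltcR; exact: eA.
Qed.

Lemma continuous_modcP (f : C^o -> C^o) z :
  {for z, continuous f} <-> forall e : R, 0 < e -> exists2 d : R, 0 < d &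
    forall w, modc (w - z) < d -> modc (f w - f z) < e.
Proof.
split=> [fz e e0|fz A /nbhs_modc[e e0 eA]].
  have /fz/nbhs_modc [d d0 dA] : nbhs (f z) [set w : C^o | modc (w - f z) < e].
    by apply/nbhs_modc; exists e.
  by exists d.
have [d d0 dA] := fz e e0; apply/nbhs_modc; exists d => // w /dA wd.
exact: eA.
Qed.

Lemma continuous_real_complex (t : R) :
  {for t, continuous (fun x : R => x%:C : C^o)}.
Proof.
move=> A /nbhs_modc[e e0 eA]; apply/nbhs_ballP; exists e => //= x tx.
by apply: eA; rewrite -rmorphB modc_real distrC.
Qed.

Lemma continuous_Re z : {for z, continuous (fun w : C^o => complex.Re w : R)}.
Proof.
move=> A /nbhs_ballP[e /= e0 eA]; apply/nbhs_modc; exists e => // w wz.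
by apply: eA; rewrite /ball /= -ReB (le_lt_trans (Re_le_modc _))// modc_distrC.
Qed.

Lemma continuous_Im z : {for z, continuous (fun w : C^o => complex.Im w : R)}.
Proof.
move=> A /nbhs_ballP[e /= e0 eA]; apply/nbhs_modc; exists e => // w wz.
by apply: eA; rewrite /ball /= -ImB (le_lt_trans (Im_le_modc _))// modc_distrC.
Qed.

Lemma continuous_modc z : {for z, continuous (fun w : C^o => modc w : R)}.
Proof.
move=> A /nbhs_ballP[e /= e0 eA]; apply/nbhs_modc; exists e => // w wz.
apply: eA; rewrite /ball /=; apply: le_lt_trans wz.
rewrite modc_distrC ler_norml modc_reverse andbT.
by rewrite lerNl opprB modc_distrC modc_reverse.
Qed.

Lemma derivable_modc (f : C -> C) z (D : C) :
  (forall e : R, 0 < e -> exists2 d : R, 0 < d & forall h, h != 0 ->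
     modc h < d -> modc ((f (z + h) - f z) / h - D) < e) ->
  derivable (f : C^o -> C^o) z 1.
Proof.
move=> fD; apply/cvg_ex; exists (D : C^o) => A /nbhs_modc[e e0 eA].
have [d d0 dA] := fD e e0.
rewrite /= /nbhs /= /dnbhs /within /=; apply/nbhs_modc; exists d => // h.
rewrite subr0 => hd h0; apply: eA.
have -> : h *: (1 : C^o) = h by rewrite /GRing.scale /= mulr1.
rewrite [h + z]addrC /GRing.scale /= mulrC; exact: dA.
Qed.

Lemma derivable_continuous_modc (f : C -> C) z :
  derivable (f : C^o -> C^o) z 1 -> {for z, continuous (f : C^o -> C^o)}.
Proof. by move=> /derivable1_diffP/differentiable_continuous. Qed.

End Modulus.

(** * Holomorphy through second-order remainders, and its stability under limits *)

Section Holomorphy.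
Local Open Scope complex_scope.
Set Implicit Arguments. Unset Strict Implicit. Unset Printing Implicit Defensive.
Variable R : realType.
Local Notation C := R[i].
Implicit Types (z w h : C).

Definition mcvg (u : nat -> C) (l : C) : Prop :=
  forall e : R, 0 < e -> exists N, forall n, (N <= n)%N -> modc (u n - l) <= e.

Lemma real_complete (u : nat -> R) :
  (forall e : R, 0 < e -> exists N, forall n, (N <= n)%N -> `|u n - u N| <= e) ->
  exists l, forall e : R, 0 < e -> exists N, forall n, (N <= n)%N ->
    `|u n - l| <= e.
Proof.
move=> cu; have : cauchy (u @ \oo).
  apply: cauchy_exP => e e0.
  have [N NP] := cu _ (divr_gt0 e0 (ltr0n _ 2)); exists (u N), N => // n /= /NP.
  by rewrite distrC /ball /= => /le_lt_trans; apply; lra.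
move=> /cauchy_cvgP /cvg_ex[l ul]; exists l => e e0.
by have /cvgr_distC_le/(_ _ e0)[N _ NP] := ul; exists N => n Nn; exact: NP.
Qed.

Lemma complex_complete (u : nat -> C) :
  (forall e : R, 0 < e -> exists N, forall n, (N <= n)%N -> modc (u n - u N) <= e) ->
  exists l, mcvg u l.
Proof.
move=> cu.
have [|a ua] := @real_complete (fun n => complex.Re (u n)).
  move=> e /cu[N NP]; exists N => n /NP; apply: le_trans.
  by rewrite -ReB; exact: Re_le_modc.
have [|b ub] := @real_complete (fun n => complex.Im (u n)).
  move=> e /cu[N NP]; exists N => n /NP; apply: le_trans.
  by rewrite -ImB; exact: Im_le_modc.
exists (a +i* b) => e e0; have e20 : 0 < e / 2 by rewrite divr_gt0.
have [N1 N1P] := ua _ e20; have [N2 N2P] := ub _ e20.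
exists (maxn N1 N2) => n; rewrite geq_max => /andP[/N1P h1 /N2P h2].
by rewrite (le_trans (modc_le_ReIm _))// ReB ImB /=; lra.
Qed.

Lemma mcvg_modc_le (u : nat -> C) l (M : R) :
  mcvg u l -> (exists N, forall n, (N <= n)%N -> modc (u n) <= M) -> modc l <= M.
Proof.
move=> ul [N0 uM]; apply/ler_addgt0Pr => e /ul[N NP].
have := NP _ (leq_maxl N N0); have := uM _ (leq_maxr N N0).
by have := modc_reverse l (u (maxn N N0)); rewrite modc_distrC; lra.
Qed.

(** The factor [c] gives the shape of a Taylor remainder, increment minus h times derivative;
    [c = 1] covers plain differences. *)
Lemma mcvg_subM (u v : nat -> C) a b c : mcvg u a -> mcvg v b ->
  mcvg (fun n => u n - c * v n) (a - c * b).
Proof.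
move=> ua vb e e0; have c0 : 0 < modc c + 1 by rewrite ltr_wpDl ?modc_ge0.
have [N1 N1P] := ua _ (divr_gt0 e0 (ltr0n _ 2)).
have [N2 N2P] := vb _ (divr_gt0 (divr_gt0 e0 (ltr0n _ 2)) c0).
exists (maxn N1 N2) => n; rewrite geq_max => /andP[/N1P h1 /N2P h2].
have -> : u n - c * v n - (a - c * b) = (u n - a) - c * (v n - b) by ring.
rewrite (le_trans (modcB _ _))// modcM.
have : modc c * modc (v n - b) <= e / 2.
  rewrite (le_trans (ler_wpM2l (modc_ge0 _) h2))// mulrA ler_pdivrMr// mulrC.
  by rewrite ler_wpM2l ?lerDl//; lra.
by move: h1; lra.
Qed.

(* The second-order remainder [K] may be uniform over a family, and then it survives
   pointwise limits: this gives holomorphy of limits without Cauchy's formula. *)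
Definition quad_diff (F : C -> C) z (d K : R) : Prop :=
  exists D, forall h, modc h < d ->
    modc (F (z + h) - F z - h * D) <= K * modc h ^+ 2.

Lemma quad_diff_derivable (F : C -> C) z (d K : R) :
  0 < d -> quad_diff F z d K -> derivable (F : C^o -> C^o) z 1.
Proof.
move=> d0 [D FD]; apply: (@derivable_modc _ _ _ D) => e e0.
(* [K] may be zero or negative, so a positive majorant of it is used as divisor. *)
have K0 : 0 < `|K| + 1 by rewrite ltr_wpDl.
exists (Num.min d (e / (`|K| + 1))); first by rewrite lt_min d0 divr_gt0.
move=> h h0; rewrite lt_min => /andP[hd he].
have mh0 : 0 < modc h by rewrite modc_gt0.
have -> : (F (z + h) - F z) / h - D = (F (z + h) - F z - h * D) / h by field.
rewrite modcM modcV ltr_pdivrMr// (le_lt_trans (FD _ hd))//.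
rewrite expr2 mulrA ltr_pM2r//; move: he; rewrite ltr_pdivlMr// => /(le_lt_trans _); apply.
rewrite mulrC ler_wpM2l ?modc_ge0//; have := ler_norm K; lra.
Qed.

(** The point is that the derivatives [D k] form a Cauchy sequence. For one small real increment x,
    [D n - D N] differs from a difference of two difference quotients by at most 2 K x, and at fixed
    x those quotients converge. *)
Lemma quad_diff_lim (F : nat -> C -> C) (g : C -> C) z (d K : R) :
  0 < d -> (forall k, quad_diff (F k) z d K) ->
  (forall h, modc h < d -> mcvg (F ^~ (z + h)) (g (z + h))) ->
  quad_diff g z d K.
Proof.
move=> d0 /choice[D FD] Fg.
have Fgz : mcvg (F ^~ z) (g z) by have := Fg 0; rewrite modc0 addr0; exact.
have Fdiff h : modc h < d -> mcvg (fun k => F k (z + h) - F k z) (g (z + h) - g z).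
  move=> hd; have := @mcvg_subM _ _ _ _ 1 (Fg h hd) Fgz.
  by rewrite mul1r; under eq_fun do rewrite mul1r.
have [|D' DD'] := @complex_complete D.
  move=> e e0; have K0 : 0 < `|K| + 1 by rewrite ltr_wpDl.
  (* Chosen so that x < d and K x <= e / 4: two Taylor remainders and two convergence errors, each
     at most e x / 4, then add up to e x. *)
  pose x := Num.min (d / 2) (e / (`|K| + 1) / 4).
  have x0 : 0 < x by rewrite lt_min !divr_gt0.
  have xd : x < d by rewrite gt_min; apply/orP; left; lra.
  have mx : modc (x%:C) = x by rewrite modc_real gtr0_norm.
  have xe : K * x <= e / 4.
    have : x <= e / (`|K| + 1) / 4 by rewrite ge_min lexx orbT.
    rewrite -mulrA [_^-1 * _]mulrC mulrA ler_pdivlMr// => /(le_trans _); apply.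
    by rewrite mulrC ler_pM2l//; have := ler_norm K; lra.
  have [N NP] : exists N, forall n, (N <= n)%N ->
     modc (F n (z + x%:C) - F n z - (g (z + x%:C) - g z)) <= e * x / 4.
    by apply: Fdiff; rewrite ?mx// !divr_gt0 ?mulr_gt0.
  exists N => n Nn.
  have := FD n x%:C; have := FD N x%:C; rewrite mx => /(_ xd) hN /(_ xd) hn.
  have gn := NP _ Nn; have gN := NP _ (leqnn N).
  rewrite -(ler_pM2r x0) -{1}mx -modcM.
  set En := F n _ - F n z in hn gn *; set EN := F N _ - F N z in hN gN *.
  set G := g _ - g z in gn gN.
  have -> : (D n - D N) * x%:C =
     (EN - x%:C * D N) - (En - x%:C * D n) + ((En - G) - (EN - G)) by ring.
  rewrite (le_trans (modcD _ _))//.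
  have := modcB (EN - x%:C * D N) (En - x%:C * D n).
  have := modcB (En - G) (EN - G).
  have : K * x ^+ 2 <= e * x / 4.
    by rewrite expr2 mulrA [leRHS]mulrAC ler_pM2r.
  by move: hn hN gn gN; lra.
exists D' => h hd.
apply: (mcvg_modc_le (mcvg_subM h (Fdiff h hd) DD')); exists 0%N => n _.
exact: FD.
Qed.

End Holomorphy.

(** * Remainder estimates for powers, power series and the kernel 1 / (1 - t z) *)

Section Kernels.
Local Open Scope complex_scope.
Set Implicit Arguments. Unset Strict Implicit. Unset Printing Implicit Defensive.
Variable R : realType.
Local Notation C := R[i].
Implicit Types (z w h : C).

(** In the binomial expansion every term other than z^n has a factor h^j with j >= 1, and |h|^j <=
    (|h| / d) d^j. *)
Lemma modc_expD_sub z h (d : R) n : 0 < d -> modc h <= d ->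
  modc ((z + h) ^+ n - z ^+ n) <= modc h / d * (modc z + d) ^+ n.
Proof.
move=> d0 hd; elim: n => [|n IH].
  by rewrite !expr0 subrr modc0 mulr1 divr_ge0 ?modc_ge0// ltW.
have -> : (z + h) ^+ n.+1 - z ^+ n.+1 =
  z * ((z + h) ^+ n - z ^+ n) + h * (z + h) ^+ n by rewrite !exprS; ring.
rewrite (le_trans (modcD _ _))// !modcM modcX exprS.
have -> : modc h / d * ((modc z + d) * (modc z + d) ^+ n) =
  modc z * (modc h / d * (modc z + d) ^+ n) + modc h * (modc z + d) ^+ n.
  by field; rewrite gt_eqF.
rewrite lerD ?ler_wpM2l ?modc_ge0// lerXn2r ?nnegrE ?modc_ge0//.
  by rewrite addr_ge0 ?modc_ge0 // ltW.
by rewrite (le_trans (modcD _ _))// lerD2l.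
Qed.

(** Here each remaining binomial term has at least two factors h. The bound contains no power of n,
    so summing it against coefficients only requires a bound for the series at the larger radius |z|
    + d. *)
Lemma modc_exp_remainder z h (d : R) n : 0 < d -> modc h <= d ->
  modc ((z + h) ^+ n - z ^+ n - h * (n%:R * z ^+ n.-1)) <=
  (modc h / d) ^+ 2 * (modc z + d) ^+ n.
Proof.
move=> d0 hd; elim: n => [|n IH].
  by rewrite !expr0 subrr mul0r mulr0 subrr modc0 mulr1 sqr_ge0.
have -> : (z + h) ^+ n.+1 - z ^+ n.+1 - h * (n.+1%:R * z ^+ n) =
  z * ((z + h) ^+ n - z ^+ n - h * (n%:R * z ^+ n.-1))
    + h * ((z + h) ^+ n - z ^+ n).
  by case: n {IH} => [|n]; rewrite ?expr1 ?expr0 /= ?exprS -!natr1; ring.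
rewrite (le_trans (modcD _ _))// !modcM [_ ^+ n.+1]exprS.
have -> : (modc h / d) ^+ 2 * ((modc z + d) * (modc z + d) ^+ n) =
  modc z * ((modc h / d) ^+ 2 * (modc z + d) ^+ n)
    + modc h * (modc h / d * (modc z + d) ^+ n).
  by field; rewrite gt_eqF.
by rewrite lerD ?ler_wpM2l ?modc_ge0// modc_expD_sub.
Qed.

Lemma nondecreasing_bounded_cauchy (T : nat -> R) (M : R) :
  {homo T : m n / (m <= n)%N >-> m <= n} -> (forall n, T n <= M) ->
  forall e : R, 0 < e -> exists N, forall n, (N <= n)%N -> T n - T N <= e.
Proof.
move=> Tnd TM e e0; have : cvg (T @ \oo).
  by apply: nondecreasing_is_cvgn => //; exists M => _ [n _ <-].
have e20 : 0 < e / 2 by rewrite divr_gt0.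
move=> /cvg_ex[l /cvgr_distC_le/(_ _ e20)[N _ NP]]; exists N => n Nn.
have := NP _ (leqnn N); have := NP _ Nn.
by rewrite /= !ler_norml => /andP[? ?] /andP[? ?]; lra.
Qed.

(** Nonnegative coefficients let the partial sums at |z| dominate those at z. The partial sums share
    the remainder constant B(|z| + d) / d^2, independent of N, so their limit is holomorphic. *)
Lemma nonneg_power_series_holo (c : nat -> R) (B : R -> R) :
  (forall n, 0 <= c n) ->
  (forall r N, 0 <= r -> r < 1 -> \sum_(n < N) c n * r ^+ n <= B r) ->
  exists f : C -> C, holo f /\ forall z, disc z ->
    mcvg (fun N => \sum_(n < N) (c n)%:C * z ^+ n) (f z).
Proof.
move=> c0 cB; pose S z N := \sum_(n < N) (c n)%:C * z ^+ n.
have modT z n : modc ((c n)%:C * z ^+ n) = c n * modc z ^+ n.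
  by rewrite modcM modc_real ger0_norm// modcX.
have /choice[f Sf] z : exists l, disc z -> mcvg (S z) l.
  have [dz|] := pselect (disc z); last by exists 0.
  have [|l Sl] := @complex_complete _ (S z); last by exists l.
  move=> e e0; pose T N := \sum_(n < N) c n * modc z ^+ n.
  have Tnd : {homo T : m n / (m <= n)%N >-> m <= n}.
    by apply/nondecreasing_seqP => n; rewrite /T big_ord_recr /= lerDl
      mulr_ge0 ?exprn_ge0 ?modc_ge0.
  have TB n : T n <= B (modc z) by apply: cB => //; exact: modc_ge0.
  have [N NP] := nondecreasing_bounded_cauchy Tnd TB e0.
  exists N => n Nn; apply: le_trans (NP _ Nn); rewrite /S /T.
  rewrite -!(big_mkord xpredT (fun n => (c n)%:C * z ^+ n)).
  rewrite -!(big_mkord xpredT (fun n => c n * modc z ^+ n)).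
  rewrite -(subnKC Nn) !(@big_cat_nat _ _ _ N 0 (N + (n - N)))/= ?leq_addr//.
  rewrite [X in modc X]addrAC subrr add0r [leRHS]addrAC subrr add0r.
  rewrite (le_trans (modc_sum _ _ _))//.
  by apply: ler_sum => i _; rewrite modT.
exists f; split=> // z dz.
(* Half the distance to the circle keeps |z| + d below 1, where [B] is a valid bound. *)
pose d := (1 - modc z) / 2; have d0 : 0 < d by rewrite divr_gt0// subr_gt0.
have dz' h : modc h < d -> disc (z + h).
  move=> hd; rewrite /disc /= (le_lt_trans (modcD _ _))//.
  by move: hd d0; rewrite /d; lra.
apply: (@quad_diff_derivable _ _ _ d (B (modc z + d) / d ^+ 2)) => //.
apply: (@quad_diff_lim _ (fun N z => S z N)) => // [N|h /dz' /Sf//].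
exists (\sum_(n < N) (c n)%:C * (n%:R * z ^+ n.-1)) => h hd.
rewrite /S mulr_sumr -!sumrB (le_trans (modc_sum _ _ _))//.
have -> : B (modc z + d) / d ^+ 2 * modc h ^+ 2 =
  (modc h / d) ^+ 2 * B (modc z + d) by field; rewrite gt_eqF.
have /(ler_wpM2l (sqr_ge0 (modc h / d))) : \sum_(n < N) c n * (modc z + d) ^+ n <=
    B (modc z + d).
  by apply: cB; [rewrite addr_ge0 ?modc_ge0// ltW|move: d0; rewrite /d; lra].
apply: le_trans; rewrite mulr_sumr; apply: ler_sum => n _.
have -> : (c n)%:C * (z + h) ^+ n - (c n)%:C * z ^+ n -
    h * ((c n)%:C * (n%:R * z ^+ n.-1)) =
    (c n)%:C * ((z + h) ^+ n - z ^+ n - h * (n%:R * z ^+ n.-1)) by ring.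
rewrite modcM modc_real ger0_norm// [leRHS]mulrCA; apply: ler_wpM2l => //.
by apply: modc_exp_remainder => //; exact: ltW.
Qed.

Lemma modc_one_sub_ge (t r : R) z : 0 <= t -> modc z <= r ->
  1 - t * r <= modc (1 - t%:C * z).
Proof.
move=> t0 zr; have := modc_reverse 1 (t%:C * z).
rewrite modc1 modcM modc_real (ger0_norm t0).
by apply: le_trans; rewrite lerD2l lerN2 ler_wpM2l.
Qed.

Lemma modc_inv_one_sub_le (t r : R) z : 0 <= t <= 1 -> modc z <= r -> r < 1 ->
  modc (1 - t%:C * z)^-1 <= (1 - r)^-1.
Proof.
move=> /andP[t0 t1] zr r1; rewrite modcV.
have : 1 - r <= modc (1 - t%:C * z).
  apply: le_trans (modc_one_sub_ge t0 zr); rewrite lerD2l lerN2 ler_piMl//.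
  exact: le_trans (modc_ge0 _) zr.
by move=> le1; rewrite lef_pV2// posrE ?subr_gt0// (lt_le_trans _ le1) ?subr_gt0.
Qed.

Lemma one_sub_neq0 (t : R) z : 0 <= t <= 1 -> disc z -> 1 - t%:C * z != 0.
Proof.
move=> /andP[t0 t1] dz; rewrite -modc_gt0.
apply: lt_le_trans (modc_one_sub_ge t0 (lexx _)); rewrite subr_gt0.
by apply: le_lt_trans dz; rewrite ler_piMl// modc_ge0.
Qed.

(** The remainder is exactly (t h)^2 / ((1 - t z)^2 (1 - t (z + h))), and each of the three inverse
    factors is at most 1 / (1 - s), uniformly in t. *)
Lemma modc_kernel_remainder (t s : R) z h : 0 <= t <= 1 ->
  modc z <= s -> modc (z + h) <= s -> s < 1 ->
  modc ((1 - t%:C * (z + h))^-1 - (1 - t%:C * z)^-1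
    - h * (t%:C / (1 - t%:C * z) ^+ 2)) <= modc h ^+ 2 * (1 - s)^-1 ^+ 3.
Proof.
move=> t01 zs zhs s1.
have q0 := one_sub_neq0 t01 (le_lt_trans zs s1).
have p0 := one_sub_neq0 t01 (le_lt_trans zhs s1).
have -> : (1 - t%:C * (z + h))^-1 - (1 - t%:C * z)^-1
    - h * (t%:C / (1 - t%:C * z) ^+ 2) =
  (t%:C * h) ^+ 2 * ((1 - t%:C * z)^-1 ^+ 2 * (1 - t%:C * (z + h))^-1).
  by field; rewrite p0 q0.
rewrite modcM !modcX modcM modc_real ler_pM ?exprn_ge0 ?mulr_ge0 ?modc_ge0 //.
  rewrite lerXn2r ?nnegrE ?mulr_ge0 ?modc_ge0// ler_piMl ?modc_ge0//.
  by case/andP: t01 => t0 t1; rewrite ger0_norm.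
rewrite modcM modcX [leRHS]exprSr ler_pM ?exprn_ge0 ?modc_ge0//.
  have inv0 : 0 <= (1 - s)^-1 by rewrite invr_ge0 subr_ge0 ltW.
  rewrite lerXn2r ?nnegrE ?modc_ge0//.
  exact: modc_inv_one_sub_le.
exact: modc_inv_one_sub_le.
Qed.

Lemma modc_geometric_remainder (t r : R) z N : 0 <= t <= 1 ->
  modc z <= r -> r < 1 ->
  modc ((1 - t%:C * z)^-1 - \sum_(n < N) z ^+ n * (t ^+ n)%:C) <= r ^+ N / (1 - r).
Proof.
move=> t01 zr r1; have q0 := one_sub_neq0 t01 (le_lt_trans zr r1).
set q := 1 - _ in q0 *.
have -> : \sum_(n < N) z ^+ n * (t ^+ n)%:C = (1 - (t%:C * z) ^+ N) / q.
  apply: (mulIf q0); rewrite mulfVK// -[X in _ = X - _](expr1n _ N) subrXX mulrC.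
  congr (_ * _); apply: eq_bigr => i _.
  by rewrite expr1n mul1r exprMn rmorphXn mulrC.
rewrite mulrBl mul1r opprB addrC subrK modcM modcX modcM modc_real.
rewrite ler_pM ?exprn_ge0 ?mulr_ge0 ?modc_ge0//; last exact: modc_inv_one_sub_le.
case/andP: t01 => t0 t1; have r0 : 0 <= r := le_trans (modc_ge0 z) zr.
rewrite lerXn2r ?nnegrE ?mulr_ge0 ?modc_ge0//.
by rewrite ger0_norm// (le_trans _ zr)// ler_piMl ?modc_ge0.
Qed.

End Kernels.

(** * Extraction of subsequences from bounded coefficients *)

Section Subsequences.
Local Open Scope complex_scope.
Set Implicit Arguments. Unset Strict Implicit. Unset Printing Implicit Defensive.
Variable R : realType.
Local Notation C := R[i].
Implicit Types (z w h : C).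

(* [L] is a cluster point of the rows of [u] in the product topology, compact by Tychonoff. *)
Lemma bounded_diagonal_subsequence (u : nat -> nat -> R) (M : R) :
  (forall k i, `|u k i| <= M) ->
  exists (phi : nat -> nat) (L : nat -> R),
    {homo phi : m n / (m < n)%N >-> (m < n)%N} /\
    forall i (e : R), 0 < e -> exists N, forall k, (N <= k)%N ->
      `|u (phi k) i - L i| <= e.
Proof.
move=> uM.
have Aco : @compact (prod_topology (fun _ : nat => R))
    [set f | forall i, `[- M, M]%classic (f i)].
  apply: (@tychonoff _ (fun=> R) (fun=> `[- M, M]%classic)) => _.
  exact: segment_compact.
have [|L [_ clL]] := Aco ((u : nat -> prod_topology (fun _ : nat => R)) @ \oo) _.
  by exists 0%N => // k _ i; rewrite /= in_itv /= -ler_norml.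
(* Only finitely many coordinates can be controlled by a neighbourhood in the product topology; both
   their number and the precision are tied to [m]. *)
have near_L m N : exists k, (N <= k)%N /\
    forall i, (i < m)%N -> `|u k i - L i| < m.+1%:R^-1.
  have [|| f [[k Nk <-] uL]] := clL [set u k | k in [set k | (N <= k)%N]]
    [set f : nat -> R | forall i : 'I_m, `|f i - L i| < m.+1%:R^-1].
  - by exists N => // k Nk; exists k.
  - have := @filter_forall (prod_topology (fun _ : nat => R)) 'I_m
      (fun i f => `|f i - L i| < m.+1%:R^-1) (nbhs L) (nbhs_filter L).
    apply=> i.
    have := @proj_continuous nat (fun _ => R) i L [set x | `|x - L i| < m.+1%:R^-1].
    apply; apply/nbhs_ballP; exists m.+1%:R^-1; first by rewrite /= invr_gt0.
    by move=> x; rewrite /ball /= distrC.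
  - by exists k; split=> // i im; exact: (uL (Ordinal im)).
pose near_L' (p : nat * nat) := near_L p.1 p.2.
have [kap kapP] := choice near_L'.
(* Asking for an index at least [(phi m').+1] makes [phi] strictly increasing. *)
pose fix phi m := match m with 0 => kap (0, 0)%N | m'.+1 => kap (m'.+1, (phi m').+1) end.
exists phi, L; split.
  apply: homo_ltn; first exact: ltn_trans.
  by move=> m; exact: (kapP (m.+1, (phi m).+1)).1.
(* From rank [N] on, coordinate [i] is among the controlled ones and the precision is finer than
   [e]; [N] is positive, which excludes the base case of [phi]. *)
move=> i e e0; pose N := maxn i.+1 (Num.truncn e^-1).+1.
exists N => -[|k]; first by rewrite /N leqNgt leq_max.
rewrite geq_max => /andP[ik ek].
have := (kapP (k.+1, (phi k).+1)).2 i ik => /= /ltW /le_trans; apply.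
rewrite -[leRHS]invrK lef_pV2 ?posrE ?invr_gt0//.
have /ltW/le_trans := truncnS_gt e^-1; apply.
by rewrite ler_nat ltnW.
Qed.

(** Real parts are stored at even positions and imaginary parts at odd ones, so one real extraction
    treats both. *)
Lemma bounded_diagonal_subsequence_complex (a : nat -> nat -> C) (M : R) :
  (forall k n, modc (a k n) <= M) ->
  exists (phi : nat -> nat) (c : nat -> C),
    {homo phi : m n / (m < n)%N >-> (m < n)%N} /\
    forall n, mcvg (fun k => a (phi k) n) (c n).
Proof.
move=> aM; pose u k i := if odd i then complex.Im (a k i./2) else complex.Re (a k i./2).
have [k i|phi [L [phi_incr uL]]] := @bounded_diagonal_subsequence u M.
  rewrite /u (le_trans _ (aM k i./2))//.
  by case: ifP => _; [exact: Im_le_modc|exact: Re_le_modc].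
exists phi, (fun n => L n.*2 +i* L n.*2.+1); split=> // n e e0.
have e20 : 0 < e / 2 by rewrite divr_gt0.
have [N1 N1P] := uL n.*2 _ e20; have [N2 N2P] := uL n.*2.+1 _ e20.
exists (maxn N1 N2) => k; rewrite geq_max => /andP[/N1P + /N2P].
rewrite /u /= odd_double /= uphalf_double doubleK => h1 h2.
by rewrite (le_trans (modc_le_ReIm _))// ReB ImB /=; lra.
Qed.

(** The truncation error does not depend on [k], so on a smaller disc finitely many coefficients
    decide convergence up to [e]. *)
Lemma bounded_coefficients_compact (F : nat -> C -> C) (a : nat -> nat -> C) (M : R) :
  (forall k n, modc (a k n) <= M) ->
  (forall k z r N, modc z <= r -> r < 1 ->
    modc (F k z - \sum_(n < N) z ^+ n * a k n) <= M * (r ^+ N / (1 - r))) ->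
  exists (phi : nat -> nat) (g : C -> C),
    {homo phi : m n / (m < n)%N >-> (m < n)%N} /\
    forall r e : R, r < 1 -> 0 < e -> exists N, forall k, (N <= k)%N ->
      forall z, modc z <= r -> modc (F (phi k) z - g z) <= e.
Proof.
move=> aM FM; have M0 : 0 <= M := le_trans (modc_ge0 _) (aM 0 0)%N.
have [phi [c [phi_incr ac]]] := bounded_diagonal_subsequence_complex aM.
have approx (r e : R) : r < 1 -> 0 < e -> exists P : C -> C, exists K, forall k,
    (K <= k)%N -> forall z, modc z <= r -> modc (F (phi k) z - P z) <= e.
  move=> r1 e0; have [r0|r0] := ltP r 0.
    exists (fun=> 0), 0%N => k _ z zr.
    by have := le_lt_trans (le_trans (modc_ge0 z) zr) r0; rewrite ltxx.
  have e20 : 0 < e / 2 by rewrite divr_gt0.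
  have [N NP] : exists N, M * (r ^+ N / (1 - r)) <= e / 2.
    (* [M + 1] in place of [M] because [M] may vanish; likewise [N.+1] below, since [N] may be 0. *)
    have X0 : 0 < e / 2 * (1 - r) / (M + 1) by rewrite !(divr_gt0, mulr_gt0) ?subr_gt0// ltr_wpDl.
    have : (fun n => r ^+ n) @ \oo --> (0 : R) by apply: cvg_expr; rewrite ger0_norm.
    move=> /cvgr_distC_le/(_ _ X0)[N _ /(_ N (leqnn N))]; rewrite /= subr0.
    rewrite ger0_norm ?exprn_ge0// ler_pdivlMr ?ltr_wpDl// => rN; exists N.
    rewrite mulrA ler_pdivrMr ?subr_gt0// (le_trans _ rN)// mulrC.
    by rewrite ler_wpM2l ?exprn_ge0// lerDl.
  have eN0 : 0 < e / 2 / N.+1%:R by rewrite !divr_gt0.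
  have /choice[K KP] n := ac n _ eN0.
  exists (fun z => \sum_(n < N) z ^+ n * c n), (\max_(n < N) K n) => k kK z zr.
  apply: le_trans (modc_triangle (\sum_(n < N) z ^+ n * a (phi k) n) _ _) _.
  rewrite [leRHS](@splitr R e) lerD//; first exact: le_trans (FM _ _ _ _ zr r1) NP.
  rewrite -sumrB (le_trans (modc_sum _ _ _))//.
  apply: (@le_trans _ _ (\sum_(n < N) e / 2 / N.+1%:R)).
    apply: ler_sum => n _; rewrite -mulrBr modcM modcX.
    rewrite -[leRHS]mul1r ler_pM ?exprn_ge0 ?modc_ge0//.
      by rewrite exprn_ile1 ?modc_ge0// ltW// (le_lt_trans zr).
    by apply: KP; rewrite (leq_trans _ kK)// (leq_bigmax n).
  rewrite sumr_const card_ord -[leLHS]mulr_natr mulrAC.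
  by rewrite ler_pdivrMr// ler_wpM2l ?(ltW e20)// ler_nat.
have ucauchy (r e : R) : r < 1 -> 0 < e -> exists K, forall k l,
    (K <= k)%N -> (K <= l)%N -> forall z, modc z <= r ->
    modc (F (phi k) z - F (phi l) z) <= e.
  move=> r1 e0; have [P [K KP]] := approx _ _ r1 (divr_gt0 e0 (ltr0n _ 2)).
  exists K => k l kK lK z zr; rewrite [leRHS](@splitr R e).
  apply: le_trans (modc_triangle (P z) _ _) _; rewrite lerD ?KP//.
  by rewrite modc_distrC KP.
(* Functions are total on [C], so the limit gets the arbitrary value 0 outside the disc. *)
have /choice[g Fg] z : exists l, disc z -> mcvg (fun k => F (phi k) z) l.
  have [dz|] := pselect (disc z); last by exists 0.
  have [|l Fl] := @complex_complete _ (fun k => F (phi k) z); last by exists l.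
  move=> e e0; have [K KP] := ucauchy _ _ dz e0; exists K => n nK.
  exact: KP.
exists phi, g; split=> // r e r1 e0; have [K KP] := ucauchy _ _ r1 e0.
exists K => k kK z zr.
have /Fg Fgz : disc z by exact: le_lt_trans zr r1.
have cst : mcvg (fun=> F (phi k) z) (F (phi k) z).
  by move=> d d0; exists 0%N => n _; rewrite subrr modc0 ltW.
have := mcvg_subM 1 cst Fgz; rewrite mul1r => /mcvg_modc_le; apply.
by exists K => n nK; rewrite mul1r KP.
Qed.

End Subsequences.

(** * Integration of complex functions over [0,1) *)

Section ComplexIntegral.
Local Open Scope complex_scope.
Set Implicit Arguments. Unset Strict Implicit. Unset Printing Implicit Defensive.
Variables (R : realType) (mu : {finite_measure set R -> \bar R}).
Local Notation C := R[i].
Local Notation D := (`[0%R, 1%R[%classic : set R).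
Implicit Types (z w h c : C) (phi psi : R -> C).

Let mD : measurable D := measurable_itv _.

(** Taken componentwise so that [Imu mu f z] is convertible to [cint mu (Ikernel f z)]. *)
Definition cint phi : C :=
  (\int[mu]_(t in D) complex.Re (phi t)) +i* (\int[mu]_(t in D) complex.Im (phi t)).

Definition cintegrable phi : Prop :=
  mu.-integrable D (EFin \o (fun t => complex.Re (phi t))) /\
  mu.-integrable D (EFin \o (fun t => complex.Im (phi t))).

Definition cmeasurable phi : Prop :=
  measurable_fun D (fun t => complex.Re (phi t)) /\
  measurable_fun D (fun t => complex.Im (phi t)).

Definition cont_disc (F : C -> C) : Prop :=
  forall z, disc z -> {for z, continuous (F : C^o -> C^o)}.

Lemma disc_real (t : R) : D t -> disc (t%:C).
Proof.
by rewrite /= in_itv /= => /andP[t0 t1]; rewrite /disc /mkset modc_real ger0_norm.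
Qed.

Lemma cont_disc_measurable (F : C -> C) :
  cont_disc F -> cmeasurable (fun t => F t%:C).
Proof.
move=> cF; split; apply: subspace_continuous_measurable_fun => //;
  apply: continuous_in_subspaceT => t /set_mem /disc_real /cF cFt.
  apply: (@continuous_comp R C^o R (fun t => F t%:C) (fun w => complex.Re w : R)).
    by apply: (@continuous_comp R C^o C^o (fun t => t%:C) F);
      [exact: continuous_real_complex|exact: cFt].
  exact: continuous_Re.
apply: (@continuous_comp R C^o R (fun t => F t%:C) (fun w => complex.Im w : R)).
  by apply: (@continuous_comp R C^o C^o (fun t => t%:C) F);
    [exact: continuous_real_complex|exact: cFt].
exact: continuous_Im.
Qed.

Lemma cintegrable_le phi (b : R -> R) : cmeasurable phi ->
  mu.-integrable D (EFin \o b) ->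
  (forall t, D t -> modc (phi t) <= b t) -> cintegrable phi.
Proof.
move=> [mRe mIm] ib phib; split.
  apply: le_integrable ib => //; first exact/measurable_EFinP.
  move=> t Dt /=; rewrite lee_fin (le_trans (Re_le_modc _))//.
  by rewrite (le_trans (phib _ Dt))// ler_norm.
apply: le_integrable ib => //; first exact/measurable_EFinP.
move=> t Dt /=; rewrite lee_fin (le_trans (Im_le_modc _))//.
by rewrite (le_trans (phib _ Dt))// ler_norm.
Qed.

(** Bounding the real and imaginary parts separately costs the factor 2 that reappears in the
    estimates of the transform. *)
Lemma modc_cint_le phi (b : R -> R) : cintegrable phi ->
  mu.-integrable D (EFin \o b) ->
  (forall t, D t -> modc (phi t) <= b t) ->
  modc (cint phi) <= 2 * \int[mu]_(t in D) b t.
Proof.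
move=> [iRe iIm] ib phib; rewrite (le_trans (modc_le_ReIm _))//= mulr2n mulrDl !mul1r.
have norm_int (f : R -> R) : mu.-integrable D (EFin \o f) ->
    mu.-integrable D (EFin \o (fun t => `|f t|)) by move/integrable_abse.
by apply: lerD; apply: le_trans (le_normr_Rintegral _ _) _ => //;
  apply: le_Rintegral => //; rewrite ?norm_int// => t Dt; apply: le_trans (phib _ Dt);
  [exact: Re_le_modc|exact: Im_le_modc].
Qed.

Lemma cintegrableB phi psi : cintegrable phi -> cintegrable psi ->
  cintegrable (fun t => phi t - psi t).
Proof.
move=> [a b] [a' b']; split.
  have := integrableB mD a a'; apply: eq_integrable mD _ _ _ => t _ /=.
  by rewrite ReB EFinB.
have := integrableB mD b b'; apply: eq_integrable mD _ _ _ => t _ /=.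
by rewrite ImB EFinB.
Qed.

Lemma cintB phi psi : cintegrable phi -> cintegrable psi ->
  cint (fun t => phi t - psi t) = cint phi - cint psi.
Proof.
move=> [a b] [a' b']; apply/eqP; rewrite eq_complex ReB ImB /=.
by rewrite -!RintegralB//; apply/andP; split; apply/eqP; apply: eq_Rintegral => t _;
  rewrite (ReB, ImB).
Qed.

Lemma cintegrableZ c phi : cintegrable phi -> cintegrable (fun t => c * phi t).
Proof.
case: c => x y [a b]; split.
  have := integrableB mD (integrableZl mD x a) (integrableZl mD y b).
  by apply: eq_integrable mD _ _ _ => t _ /=; case: (phi t).
have := integrableD mD (integrableZl mD x b) (integrableZl mD y a).
by apply: eq_integrable mD _ _ _ => t _ /=; case: (phi t).
Qed.

Lemma cintZ c phi : cintegrable phi -> cint (fun t => c * phi t) = c * cint phi.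
Proof.
case: c => x y [a b]; have Z (f : R -> R) k : mu.-integrable D (EFin \o f) ->
  mu.-integrable D (EFin \o (fun t => k * f t)).
  by move=> /(integrableZl mD k).
apply/eqP; rewrite eq_complex /=; apply/andP; split; apply/eqP.
  rewrite -!RintegralZl// -RintegralB//; [|exact: Z..].
  by apply: eq_Rintegral => t _; case: (phi t).
rewrite -!RintegralZl// -RintegralD//; [|exact: Z..].
by apply: eq_Rintegral => t _; case: (phi t).
Qed.

Lemma cintegrable0 : cintegrable (fun=> 0).
Proof. by split; exact: integrable0. Qed.

Lemma cint0 : cint (fun=> 0) = 0.
Proof. by rewrite /cint /= /Rintegral integral0. Qed.

Lemma cintegrable_sum n (phi : nat -> R -> C) :
  (forall i, cintegrable (phi i)) -> cintegrable (fun t => \sum_(i < n) phi i t).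
Proof.
move=> iphi; elim: n => [|n IH].
  by under eq_fun do rewrite big_ord0; exact: cintegrable0.
have := cintegrableB IH (cintegrableZ (-1) (iphi n)).
congr cintegrable; apply/funext => t.
by rewrite big_ord_recr /= mulN1r opprK.
Qed.

Lemma cint_sum n (phi : nat -> R -> C) : (forall i, cintegrable (phi i)) ->
  cint (fun t => \sum_(i < n) phi i t) = \sum_(i < n) cint (phi i).
Proof.
move=> iphi; elim: n => [|n IH].
  by rewrite big_ord0; under eq_fun do rewrite big_ord0; exact: cint0.
rewrite big_ord_recr /= -IH -[cint (phi n)]opprK -[- cint (phi n)]mulN1r.
rewrite -cintZ// -cintB; last 2 first.
- exact: cintegrable_sum.
- exact: cintegrableZ.
by congr cint; apply/funext => t; rewrite big_ord_recr /= mulN1r opprK.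
Qed.

End ComplexIntegral.

(** * The transform of functions dominated on [0,1) by an integrable [G] *)

Section DominatedTransform.
Local Open Scope complex_scope.
Set Implicit Arguments. Unset Strict Implicit. Unset Printing Implicit Defensive.
Variables (R : realType) (mu : {finite_measure set R -> \bar R}).
Local Notation C := R[i].
Local Notation D := (`[0%R, 1%R[%classic : set R).
Implicit Types (z w h c : C) (f k : C -> C).
Let mD : measurable D := measurable_itv _.

Lemma cont_disc_cst c : cont_disc (fun=> c).
Proof.
move=> z _; apply/continuous_modcP => e e0; exists 1 => // w _.
by rewrite subrr modc0.
Qed.

Lemma cont_disc_id : cont_disc (fun w : C => w).
Proof. by move=> z _; apply/continuous_modcP => e e0; exists e. Qed.

Lemma cont_discM f k : cont_disc f -> cont_disc k -> cont_disc (fun w => f w * k w).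
Proof.
by move=> cf ck z dz; apply: (@continuousM C C^o f k z); [exact: cf|exact: ck].
Qed.

Lemma cont_discB f k : cont_disc f -> cont_disc k -> cont_disc (fun w => f w - k w).
Proof.
by move=> cf ck z dz; apply: (@continuousB C C^o C^o f k z); [exact: cf|exact: ck].
Qed.

Lemma cont_discX f n : cont_disc f -> cont_disc (fun w => f w ^+ n).
Proof.
move=> cf; elim: n => [|n IH]; first by under eq_fun do rewrite expr0; exact: cont_disc_cst.
by under eq_fun do rewrite exprS; exact: cont_discM.
Qed.

Lemma cont_disc_kernel z : disc z -> cont_disc (fun w => (1 - w * z)^-1).
Proof.
move=> dz w dw; apply: (@continuousV C C^o (fun w => 1 - w * z) w).
  rewrite subr_eq0 eq_sym; apply: contraTneq isT => wz1.
  have : modc (w * z) < 1.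
    rewrite modcM; apply: le_lt_trans dz.
    by rewrite ler_piMl ?modc_ge0// ltW.
  by rewrite wz1 modc1 ltxx.
have cz := cont_discM cont_disc_id (@cont_disc_cst z).
exact: (cont_discB (@cont_disc_cst 1) cz dw).
Qed.

Lemma holo_cont_disc f : holo f -> cont_disc f.
Proof. by move=> hf z /hf; exact: derivable_continuous_modc. Qed.

Lemma unit_interval (t : R) : D t -> 0 <= t <= 1.
Proof. by rewrite /= in_itv /= => /andP[-> /ltW]. Qed.

Variable G : R -> R.
Hypothesis iG : mu.-integrable D (EFin \o G).
Hypothesis G0 : forall t, D t -> 0 <= G t.
Local Notation I := (\int[mu]_(t in D) G t).

(** What remains of the weighted norm once f is seen on [0,1) only. Continuity replaces holomorphy:
    it gives measurability and passes to differences at once. *)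
Definition dominated f (M : R) : Prop :=
  cont_disc f /\ forall t, D t -> modc (f t%:C) <= M * G t.

Lemma dominated_integrable f M k (B : R) : dominated f M -> cont_disc k ->
  (forall t, D t -> modc (k t%:C) <= B) ->
  cintegrable mu (fun t => f t%:C * k t%:C).
Proof.
move=> [cf fM] ck kB.
apply: (@cintegrable_le _ _ _ (fun t => (M * B) * G t)).
- exact: (cont_disc_measurable (cont_discM cf ck)).
- exact: (integrableZl mD (M * B) iG).
- by move=> t Dt; rewrite modcM mulrAC ler_pM ?modc_ge0 ?fM ?kB.
Qed.

Lemma dominated_cint_le f M k (B : R) : dominated f M -> cont_disc k ->
  (forall t, D t -> modc (k t%:C) <= B) ->
  modc (cint mu (fun t => f t%:C * k t%:C)) <= 2 * M * I * B.
Proof.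
move=> fM ck kB.
have := @modc_cint_le _ mu _ (fun t => (M * B) * G t) (dominated_integrable fM ck kB).
rewrite RintegralZl// => /(_ (integrableZl mD (M * B) iG)) le_int.
rewrite (le_trans (le_int _))//; last by rewrite le_eqVlt; apply/orP; left; apply/eqP; ring.
by move=> t Dt; rewrite modcM mulrAC ler_pM ?modc_ge0 ?fM.2 ?kB.
Qed.

Lemma kernel_le z (r : R) : modc z <= r -> r < 1 ->
  forall t, D t -> modc (1 - t%:C * z)^-1 <= (1 - r)^-1.
Proof. by move=> zr r1 t /unit_interval t01; exact: modc_inv_one_sub_le. Qed.

Lemma Imu_integrable f M z : dominated f M -> disc z ->
  cintegrable mu (Ikernel f z).
Proof.
move=> fM dz; apply: (dominated_integrable fM (cont_disc_kernel dz)).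
exact: kernel_le (lexx _) dz.
Qed.

Lemma ImuB f g M N z : dominated f M -> dominated g N -> disc z ->
  Imu mu (fun w => f w - g w) z = Imu mu f z - Imu mu g z.
Proof.
move=> fM gN dz; rewrite -[Imu mu f z]/(cint mu (Ikernel f z)).
rewrite -[Imu mu g z]/(cint mu (Ikernel g z)) -cintB.
- by congr cint; apply/funext => t; rewrite /Ikernel mulrBl.
- exact: Imu_integrable fM dz.
- exact: Imu_integrable gN dz.
Qed.

Lemma Imu_le f M z (r : R) : dominated f M -> modc z <= r -> r < 1 ->
  modc (Imu mu f z) <= 2 * M * I * (1 - r)^-1.
Proof.
move=> fM zr r1; have dz : disc z := le_lt_trans zr r1.
exact: (dominated_cint_le fM (cont_disc_kernel dz) (kernel_le zr r1)).
Qed.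

(** Differentiation under the integral in quantitative form; [k3] is the z-derivative of the kernel,
    t / (1 - t z)^2. The constant depends on f only through [M], hence is common to the whole unit
    ball. *)
Lemma Imu_quad_diff f M z (s : R) : dominated f M -> modc z < s -> s < 1 ->
  quad_diff (Imu mu f) z (s - modc z) (2 * M * I * (1 - s)^-1 ^+ 3).
Proof.
move=> fM zs s1; have dz : disc z := lt_trans zs s1.
pose k1 z w := (1 - w * z)^-1; pose k3 w := w * k1 z w ^+ 2.
have ck z' : disc z' -> cont_disc (k1 z') by exact: cont_disc_kernel.
have ck3 : cont_disc k3.
  by apply: cont_discM; [exact: cont_disc_id|apply: cont_discX; exact: ck].
have k3_le t : D t -> modc (k3 t%:C) <= 1 * (1 - modc z)^-1 ^+ 2.
  move=> Dt; have /andP[t0 t1] := unit_interval Dt.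
  rewrite modcM modcX modc_real ger0_norm//.
  rewrite ler_pM ?exprn_ge0 ?modc_ge0// lerXn2r ?nnegrE ?modc_ge0//.
    by rewrite invr_ge0 subr_ge0 ltW.
  exact: (kernel_le (lexx _) dz).
exists (cint mu (fun t => f t%:C * k3 t%:C)) => h hs.
have zhs : modc (z + h) <= s by rewrite (le_trans (modcD _ _))//; lra.
have dzh : disc (z + h) := le_lt_trans zhs s1.
have i1 := Imu_integrable fM dzh; have i2 := Imu_integrable fM dz.
have i3 := dominated_integrable fM ck3 k3_le.
rewrite -cintZ// -[Imu mu f (z + h)]/(cint mu (Ikernel f (z + h))).
rewrite -[Imu mu f z]/(cint mu (Ikernel f z)) -cintB// -cintB//; last 2 first.
- exact: cintegrableB.
- exact: cintegrableZ.
have -> : (fun t => Ikernel f (z + h) t - Ikernel f z t - h * (f t%:C * k3 t%:C)) =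
  (fun t => f t%:C * (k1 (z + h) t%:C - k1 z t%:C - h * k3 t%:C)).
  by apply/funext => t; rewrite /Ikernel /k1; ring.
rewrite -mulrA [_ ^+ 3 * _]mulrC.
apply: (dominated_cint_le (k := fun w => k1 (z + h) w - k1 z w - h * k3 w) fM).
  apply: cont_discB; first by apply: cont_discB; exact: ck.
  exact: cont_discM (@cont_disc_cst h) ck3.
move=> t /unit_interval t01; rewrite /k3 /k1 exprVn.
by apply: modc_kernel_remainder => //; exact: ltW.
Qed.

Lemma Imu_holo f M : dominated f M -> holo (Imu mu f).
Proof.
move=> fM z dz; pose s := (1 + modc z) / 2.
have [zs s1] : modc z < s /\ s < 1 by rewrite /s; move: dz; rewrite /disc/mkset; lra.
by apply: quad_diff_derivable (Imu_quad_diff fM zs s1); rewrite subr_gt0.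
Qed.

Lemma dominated_Imu_def f M : dominated f M -> Imu_def mu f.
Proof.
by move=> fM; split; [move=> z dz; exact: Imu_integrable fM dz|exact: Imu_holo fM].
Qed.

Definition Imu_coef f n : C := cint mu (fun t => f t%:C * t%:C ^+ n).

Lemma modc_exp_le1 n t : D t -> modc (t%:C ^+ n) <= 1.
Proof.
move=> /unit_interval /andP[t0 t1].
by rewrite modcX modc_real ger0_norm// exprn_ile1.
Qed.

Lemma Imu_coef_le f M n : dominated f M -> modc (Imu_coef f n) <= 2 * M * I.
Proof.
move=> fM; rewrite -[leRHS]mulr1.
apply: (dominated_cint_le (k := fun w => w ^+ n) fM); last exact: modc_exp_le1.
by apply: cont_discX; exact: cont_disc_id.
Qed.

Lemma Imu_approx f M z (r : R) N : dominated f M -> modc z <= r -> r < 1 ->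
  modc (Imu mu f z - \sum_(n < N) z ^+ n * Imu_coef f n)
    <= 2 * M * I * (r ^+ N / (1 - r)).
Proof.
move=> fM zr r1; have dz : disc z := le_lt_trans zr r1.
have cX n : cont_disc (fun w => w ^+ n) by apply: cont_discX; exact: cont_disc_id.
have iX n := dominated_integrable fM (cX n) (@modc_exp_le1 n).
have iz := Imu_integrable fM dz.
under eq_bigr do rewrite -cintZ//.
rewrite -(@cint_sum _ _ N (fun n t => z ^+ n * (f t%:C * t%:C ^+ n))); last first.
  by move=> n; exact: cintegrableZ.
rewrite -[Imu mu f z]/(cint mu (Ikernel f z)) -cintB//; last first.
  apply: (@cintegrable_sum _ _ N (fun n t => z ^+ n * (f t%:C * t%:C ^+ n))) => n.
  exact: cintegrableZ.
have -> : (fun t => Ikernel f z t - \sum_(n < N) z ^+ n * (f t%:C * t%:C ^+ n)) =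
  (fun t => f t%:C * ((1 - t%:C * z)^-1 - \sum_(n < N) z ^+ n * t%:C ^+ n)).
  apply/funext => t; rewrite /Ikernel mulrBr mulr_sumr; congr (_ - _).
  by apply: eq_bigr => n _; rewrite mulrCA.
apply: (dominated_cint_le (k := fun w => (1 - w * z)^-1 - \sum_(n < N) z ^+ n * w ^+ n) fM).
  apply: cont_discB; first exact: cont_disc_kernel.
  elim: N => [|N IH].
    by under eq_fun do rewrite big_ord0; exact: cont_disc_cst.
  under eq_fun do rewrite big_ord_recr /= -[X in _ + X]opprK -mulNr.
  exact: cont_discB IH (cont_discM (@cont_disc_cst (- z ^+ N)) (cX N)).
move=> t /unit_interval t01.
have := modc_geometric_remainder N t01 zr r1.
by under eq_bigr do rewrite rmorphXn.
Qed.

Definition bdry (r : R) : R := \int[mu]_(t in D) (G t * ((1 - r) / (1 - t * r))).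

Lemma bdry_kernel_bounds (r t : R) : 0 <= r -> r < 1 -> D t ->
  0 <= (1 - r) / (1 - t * r) <= 1.
Proof.
move=> r0 r1; rewrite /= in_itv /= => /andP[t0 t1].
have tr : t * r <= r by rewrite ler_piMl// ltW.
rewrite divr_ge0 ?subr_ge0 ?(ltW r1) //; last by rewrite (le_trans tr)// ltW.
rewrite ler_pdivrMr ?mul1r ?lerD2l ?lerN2// subr_gt0; exact: le_lt_trans r1.
Qed.

Lemma bdry_kernel_measurable (r : R) : 0 <= r -> r < 1 ->
  measurable_fun D (fun t => G t * ((1 - r) / (1 - t * r))).
Proof.
move=> r0 r1; apply: measurable_funM.
  by apply/measurable_EFinP; exact: measurable_int iG.
(* The real quotient is the real part of a multiple of the complex kernel at the point r, whose
   continuity is known. *)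
have dr : disc r%:C by rewrite /disc /mkset modc_real ger0_norm.
have /cont_disc_measurable[+ _] :=
  cont_discM (@cont_disc_cst (1 - r)%:C) (cont_disc_kernel dr).
apply: eq_measurable_fun => t _.
have -> : (1 : C) = (1%:C)%R by [].
by rewrite -rmorphM -rmorphB -fmorphV -rmorphM.
Qed.

Lemma bdry_integrable (r : R) : 0 <= r -> r < 1 ->
  mu.-integrable D (EFin \o (fun t => G t * ((1 - r) / (1 - t * r)))).
Proof.
move=> r0 r1; apply: le_integrable iG => //.
  by apply/measurable_EFinP; exact: bdry_kernel_measurable.
move=> t Dt /=; rewrite lee_fin; have /andP[k0 k1] := bdry_kernel_bounds r0 r1 Dt.
by rewrite normrM ler_piMr// ger0_norm.
Qed.

(** After clearing denominators the integrands compare by (1 - t)(r' - r) >= 0. This extends a limit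
    along one sequence to all radii near 1. *)
Lemma bdry_nonincreasing (r r' : R) : 0 <= r -> r <= r' -> r' < 1 ->
  bdry r' <= bdry r.
Proof.
move=> r0 rr' r'1; apply: le_Rintegral => //.
- by apply: bdry_integrable => //; exact: le_trans rr'.
- by apply: bdry_integrable => //; exact: le_lt_trans r'1.
move=> t Dt; apply: ler_wpM2l; first exact: G0.
move: Dt; rewrite /= in_itv /= => /andP[t0 t1].
have tr r1 : 0 <= r1 -> r1 < 1 -> 0 < 1 - t * r1.
  by move=> r10 r11; rewrite subr_gt0 (le_lt_trans _ r11)// ler_piMl// ltW.
have p1 := tr _ r0 (le_lt_trans rr' r'1); have p2 := tr _ (le_trans r0 rr') r'1.
rewrite ler_pdivrMr// mulrAC ler_pdivlMr// -subr_ge0.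
have -> : (1 - r) * (1 - t * r') - (1 - r') * (1 - t * r) = (1 - t) * (r' - r) by ring.
by rewrite mulr_ge0// subr_ge0// ltW.
Qed.

Lemma bdry_cvg0 (e : R) : 0 < e -> exists r0 : R, [/\ 0 <= r0, r0 < 1 &
  forall r, r0 <= r -> r < 1 -> bdry r <= e].
Proof.
(* Dominated convergence applies to sequences; monotonicity then covers every r >= [rn N]. *)
move=> e0; pose rn n : R := 1 - n.+1%:R^-1.
have rn0 n : 0 <= rn n by rewrite subr_ge0 invf_le1// ler1n.
have rn1 n : rn n < 1 by rewrite /rn ltrBlDr ltrDl invr_gt0.
pose fn n t := (G t * ((1 - rn n) / (1 - t * rn n)))%:E.
have [|||||_ _] := @dominated_convergence _ _ _ mu D mD fn (fun=> 0%E) (EFin \o G).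
- by move=> n; apply/measurable_EFinP; exact: bdry_kernel_measurable.
- exact: measurable_cst.
- apply: aeW => t Dt; rewrite /fn.
  apply: cvg_EFin; first by apply: nearW.
  have Gt := G0 Dt; move: (Dt); rewrite /= in_itv /= => /andP[t0 t1].
  (* For fixed t < 1 the denominator stays at least 1 - t, while the numerator 1 - [rn n] is 1 / (n
     + 1). *)
  apply: (@squeeze_cvgr _ _ _ _ (fun=> 0) (fun n => G t / (1 - t) * n.+1%:R^-1)).
  + apply: nearW => n; have /andP[k0 k1] := bdry_kernel_bounds (rn0 n) (rn1 n) Dt.
    rewrite mulr_ge0//= -mulrA ler_wpM2l// /rn subKr mulrC.
    rewrite ler_wpM2r ?invr_ge0// lef_pV2 ?posrE ?subr_gt0//.
      by rewrite lerD2l lerN2 ler_piMr// gerBl invr_ge0.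
    by rewrite (le_lt_trans _ t1)// ler_piMr// gerBl invr_ge0.
  + exact: cvg_cst.
  + rewrite -[X in _ --> X](mulr0 (G t / (1 - t))).
    by apply: cvgM; [exact: cvg_cst|exact: cvg_harmonic].
- exact: iG.
- apply: aeW => t n Dt; rewrite /fn /= lee_fin.
  have /andP[k0 k1] := bdry_kernel_bounds (rn0 n) (rn1 n) Dt.
  by rewrite normrM [`|G t|]ger0_norm ?G0// ler_piMr ?G0// ger0_norm.
rewrite integral0 => /fine_cvg /cvgr_distC_le/(_ _ e0)[N _ /(_ N (leqnn N))].
rewrite /= subr0 => bN; exists (rn N); split => // r rNr r1.
apply: le_trans (bdry_nonincreasing (rn0 N) rNr r1) _.
exact: le_trans (ler_norm _) bN.
Qed.

Lemma Imu_bdry_le f M z : dominated f M -> disc z ->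
  (1 - modc z) * modc (Imu mu f z) <= 2 * M * bdry (modc z).
Proof.
move=> fM dz; set r := modc z; have r0 : 0 <= r := modc_ge0 z.
have r1 : r < 1 := dz; have r1' : 0 < 1 - r by rewrite subr_gt0.
(* This is M G(t) / (1 - t r), written with a cancelling 1 - r so that its integral is a multiple of
   [bdry mu G r]. *)
pose b t := M / (1 - r) * (G t * ((1 - r) / (1 - t * r))).
have ib := integrableZl mD (M / (1 - r)) (bdry_integrable r0 r1).
have := @modc_cint_le _ mu (Ikernel f z) b (Imu_integrable fM dz) ib.
have -> : \int[mu]_(t in D) b t = M / (1 - r) * bdry r.
  by rewrite RintegralZl//; exact: bdry_integrable.
move=> le_int; rewrite mulrC -ler_pdivlMr//.
have -> : 2 * M * bdry r / (1 - r) = 2 * (M / (1 - r) * bdry r).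
  by field; rewrite gt_eqF.
apply: le_int => t Dt; have /unit_interval/andP[t0 t1] := Dt.
have tr : 0 < 1 - t * r by rewrite subr_gt0 (le_lt_trans _ r1)// ler_piMl.
have -> : b t = M * G t * (1 - t * r)^-1 by rewrite /b; field; rewrite !gt_eqF.
rewrite modcM ler_pM ?modc_ge0 ?fM.2// modcV.
have := modc_one_sub_ge t0 (lexx (modc z)); rewrite -/r => lb.
by rewrite lef_pV2 ?posrE// (lt_le_trans tr).
Qed.

End DominatedTransform.

(** * Two-sided comparison of the test series with (1 - t)^(-g) *)

Section PowerSums.
Set Implicit Arguments. Unset Strict Implicit. Unset Printing Implicit Defensive.
Variables (R : realType) (g : R).
Hypothesis g0 : 0 < g.

(* The value at [n = 0] replaces [0 `^ (g - 1)], which Rocq evaluates to [0] or [1]. *)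
Definition power_coef (n : nat) : R := if n is 0 then 1 else n%:R `^ (g - 1).

Lemma power_coef_ge0 n : 0 <= power_coef n.
Proof. by case: n => [|n] //=; exact: powR_ge0. Qed.

Lemma powR_split (x : R) : 0 < x -> x `^ g = x * x `^ (g - 1).
Proof. by move=> x0; rewrite mulr_powRB1// ltW. Qed.

(** For g >= 1 take c = 1: the increment is (n+1)^(g-1) plus n ((n+1)^(g-1) - n^(g-1)). For g < 1
    take c = 1 / g: concavity, in the form of the tangent bound x^g <= g x + 1 - g at x = n /
    (n+1). *)
Lemma powR_difference_bound : exists2 c : R, 0 < c & forall n : nat,
  n.+1%:R `^ (g - 1) <= c * (n.+1%:R `^ g - n%:R `^ g).
Proof.
have [g1|g1] := leP 1 g.
  exists 1 => // n; rewrite mul1r powR_split// -natr1 mulrDl mul1r addrAC.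
  rewrite lerDr subr_ge0; case: n => [|n]; first by rewrite mul0r powR0// gt_eqF.
  rewrite powR_split// ler_wpM2l// ge0_ler_powR ?nnegrE ?subr_ge0//.
  by rewrite lerDl.
exists g^-1 => [|n]; first by rewrite invr_gt0.
set y : R := n.+1%:R; have y0 : 0 < y by exact: ltr0Sn.
pose x := n%:R / y; have x0 : 0 <= x by rewrite divr_ge0.
have nE : n%:R = y * x by rewrite /x mulrC divfK// gt_eqF.
have xE : x = 1 - y^-1.
  by rewrite /x -(addrK 1 n%:R) natr1 mulrBl divff ?gt_eqF// mul1r.
(* Young's inequality for the product of x^g and 1, with conjugate exponents 1 / g and 1 / (1 -
   g). *)
have young : x `^ g <= g * x + (1 - g).
  have g1' : 0 < 1 - g by rewrite subr_gt0.
  have := @conjugate_powR R (x `^ g) 1 g^-1 (1 - g)^-1 (powR_ge0 _ _) ler01.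
  rewrite !invr_gt0 !invrK mulr1 powR1 mul1r -powRrM divff ?gt_eqF// powRr1//.
  have gE : g + (1 - g) = 1 by lra.
  by move=> /(_ g0 g1' gE); rewrite [x * g]mulrC.
rewrite nE powRM ?(ltW y0)// (powR_split y0) mulrC ler_pdivlMr//.
have Y0 : 0 < y `^ (g - 1) by exact: powR_gt0.
rewrite -[X in _ <= X - _]mulr1 -mulrBr [y * _]mulrC -mulrA ler_pM2l//.
have : y * x `^ g <= y * (g * x + (1 - g)) by rewrite ler_pM2l.
rewrite xE mulrBr mulr1; have -> : y * (g * (1 - y^-1) + (1 - g)) = y - g.
  by field; rewrite gt_eqF.
by lra.
Qed.

(** With x = n s, the power is at most exp(-x / 2), and x^g exp(-x / 2) <= (2 g)^g is u <= exp u
    raised to the power g, for u = x / (2 g). *)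
Lemma powR_mul_geometric_bound (s : R) n : 0 < s -> s <= 1 ->
  n%:R `^ g * (1 - s / 2) ^+ n <= (2 * g) `^ g * (s `^ g)^-1.
Proof.
move=> s0 s1; rewrite ler_pdivlMr ?powR_gt0// mulrAC -powRM ?(ltW s0)//.
set x := n%:R * s; have x0 : 0 <= x by rewrite mulr_ge0// ltW.
have g20 : 0 < 2 * g by rewrite mulr_gt0.
have qx : (1 - s / 2) ^+ n <= expR (- (x / 2)).
  have -> : - (x / 2) = n%:R * - (s / 2) by rewrite /x; field.
  have q0 : 0 <= 1 - s / 2 by lra.
  rewrite expRM_natl lerXn2r ?nnegrE ?expR_ge0//.
  exact: expR_ge1Dx.
have xe : x `^ g <= (2 * g) `^ g * expR (x / 2).
  have -> : x / 2 = x / (2 * g) * g by field; rewrite gt_eqF.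
  rewrite expRM -powRM ?expR_ge0 ?(ltW g20)// ge0_ler_powR ?nnegrE ?(ltW g0)//.
    by rewrite mulr_ge0 ?expR_ge0 ?(ltW g20).
  rewrite [leRHS]mulrC -ler_pdivrMr//; have := expR_ge1Dx (x / (2 * g)); lra.
have q0 : 0 <= 1 - s / 2 by lra.
rewrite (le_trans (ler_pM _ _ xe qx)) ?powR_ge0 ?exprn_ge0//.
by rewrite -mulrA -expRD subrr expR0 mulr1.
Qed.

Lemma abel_summation (A : nat -> R) (t : R) N : A 0%N = 0 ->
  \sum_(n < N) (A n.+1 - A n) * t ^+ n.+1 =
  A N * t ^+ N + \sum_(n < N) A n * t ^+ n * (1 - t).
Proof.
move=> A0; elim: N => [|N IH]; first by rewrite !big_ord0 A0 mul0r addr0.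
by rewrite !big_ord_recr /= IH !exprS; ring.
Qed.

(* The coefficients are dominated by the increments of [n `^ g]; Abel summation then leaves
   [(1 - t) * \sum n `^ g * t ^+ n], with [t <= q ^+ 2] for [q = 1 - (1 - t) / 2]: one factor
   [q ^+ n] absorbs [n `^ g] and the other is summed. *)
Lemma power_sum_le : exists2 c : R, 0 < c & forall (t : R) N, 0 <= t -> t < 1 ->
  \sum_(n < N) power_coef n * t ^+ n <= c * ((1 - t) `^ g)^-1.
Proof.
have [c1 c10 c1P] := powR_difference_bound; pose K := (2 * g) `^ g.
have K0 : 0 <= K by exact: powR_ge0.
(* The summand 1 pays for index 0. In the 3, one unit is the boundary term of the Abel summation and
   two come from the bound 2 / s on the geometric sum, multiplied by s. *)
exists (1 + c1 * (3 * K)); first by rewrite ltr_wpDr// mulr_ge0 ?mulr_ge0// ltW.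
move=> t N t0 t1; set s := 1 - t; pose q := 1 - s / 2.
have s0 : 0 < s by rewrite subr_gt0.
have s1 : s <= 1 by rewrite /s; lra.
have q0 : 0 < q by rewrite /q; lra.
have q1 : q < 1 by rewrite /q; lra.
have tq : t <= q * q.
  rewrite -subr_ge0; have -> : q * q - t = (s / 2) ^+ 2 by rewrite /q /s; field.
  exact: sqr_ge0.
have tqn n : t ^+ n <= q ^+ n * q ^+ n.
  by rewrite -exprMn lerXn2r ?nnegrE// mulr_ge0// ltW.
have qn1 n : q ^+ n <= 1 by rewrite exprn_ile1// ltW.
set S := (s `^ g)^-1; have S0 : 0 < S by rewrite invr_gt0 powR_gt0.
have S1 : 1 <= S.
  rewrite invf_ge1 ?powR_gt0//; apply: (@le_trans _ _ (1 `^ g)); last by rewrite powR1.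
  by rewrite ge0_ler_powR ?nnegrE// ltW.
pose A n : R := n%:R `^ g.
have Aq n : A n * q ^+ n <= K * S by exact: powR_mul_geometric_bound.
have A0 n : 0 <= A n by exact: powR_ge0.
have main M : \sum_(n < M) (A n.+1 - A n) * t ^+ n.+1 <= 3 * (K * S).
  rewrite abel_summation; last by rewrite /A powR0// gt_eqF.
  have geo : \sum_(n < M) q ^+ n <= 2 / s.
    have := subrXX (1 : R) q M; rewrite expr1n.
    under eq_bigr do rewrite expr1n mul1r.
    have -> : 1 - q = s / 2 by rewrite /q; lra.
    move=> geoE; rewrite -[2 / s]invf_div -div1r ler_pdivlMr ?divr_gt0//.
    by rewrite mulrC -geoE gerBl exprn_ge0// ltW.
  have -> : 3 * (K * S) = K * S + K * S * (2 / s) * s by field; rewrite gt_eqF.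
  apply: lerD.
    rewrite (le_trans _ (Aq M))// ler_wpM2l// (le_trans (tqn M))//.
    by rewrite ler_piMl// exprn_ge0// ltW.
  rewrite -mulr_suml ler_wpM2r ?(ltW s0)//.
  have KS0 : 0 <= K * S by rewrite mulr_ge0// ltW.
  apply: le_trans (ler_wpM2l KS0 geo); rewrite mulr_sumr; apply: ler_sum => n _.
  rewrite (le_trans (ler_wpM2l (A0 n) (tqn n)))// mulrA ler_wpM2r//.
  by rewrite exprn_ge0// ltW.
case: N => [|N].
  by rewrite big_ord0 mulr_ge0 ?(ltW S0)// addr_ge0// mulr_ge0 ?(ltW c10)// mulr_ge0.
rewrite big_ord_recl /= expr0 mulr1 mulrDl mul1r lerD// -!mulrA.
apply: le_trans (ler_wpM2l (ltW c10) (main N)).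
by rewrite mulr_sumr; apply: ler_sum => n _; rewrite mulrA ler_wpM2r ?exprn_ge0.
Qed.

Lemma bernoulli_le (s : R) n : 0 <= s -> s <= 1 -> 1 - n%:R * s <= (1 - s) ^+ n.
Proof.
move=> s0 s1; elim: n => [|n IH]; first by rewrite mul0r subr0 expr0.
rewrite exprS; have s1' : 0 <= 1 - s by rewrite subr_ge0.
apply: le_trans (ler_wpM2l s1' IH); rewrite -natr1 -subr_ge0.
have -> : (1 - s) * (1 - n%:R * s) - (1 - (n%:R + 1) * s) = n%:R * s ^+ 2 by ring.
by rewrite mulr_ge0// sqr_ge0.
Qed.

(* With [m] about [1 / (4 (1 - t))], the terms of index in [[m, 2 m[] suffice. *)
Lemma power_sum_ge : exists2 c : R, 0 < c & forall t : R, 0 <= t -> t < 1 ->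
  exists N, c * ((1 - t) `^ g)^-1 <= \sum_(n < N) power_coef n * t ^+ n.
Proof.
(* The m terms are each at least m^g / (2 m) times 1/2, so they sum to at least m^g / 4; then m >= 1
   / (8 s) is used. *)
exists (8^-1 `^ g / 4); first by rewrite divr_gt0 ?powR_gt0 ?invr_gt0.
move=> t t0 t1; set s := 1 - t.
have s0 : 0 < s by rewrite subr_gt0.
have s1 : s <= 1 by rewrite /s; lra.
have E8 : 8^-1 `^ g / 4 * (s `^ g)^-1 = ((8 * s)^-1) `^ g / 4.
  have -> : (s `^ g)^-1 = s^-1 `^ g.
    by rewrite -powR_inv1 ?powR_ge0// -powRrM mulrC powRrM powR_inv1// ltW.
  by rewrite mulrAC -powRM ?invr_ge0 ?(ltW s0)// -invfM.
(* Away from t = 1 the term of index 0 already suffices; otherwise s <= 1/8, which makes [m]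
   positive. *)
rewrite E8; have [s8|s8] := ltP 8^-1 s.
  exists 1%N; rewrite big_ord1 expr0 mulr1 /=.
  rewrite ler_pdivrMr// mul1r (@le_trans _ _ 1)//; last by lra.
  apply: (@le_trans _ _ (1 `^ g)); last by rewrite powR1.
  rewrite ge0_ler_powR ?nnegrE ?invr_ge0 ?mulr_ge0 ?(ltW s0) ?(ltW g0)//.
  by rewrite invf_le1 ?mulr_gt0//; lra.
have s40 : 0 < 4 * s by rewrite mulr_gt0.
pose m := Num.truncn (4 * s)^-1.
have ms : m%:R * (4 * s) <= 1.
  by rewrite -ler_pdivlMr// div1r truncn_le ?invr_ge0 ?(ltW s40).
have m1s : 1 < m.+1%:R * (4 * s).
  by rewrite -ltr_pdivrMr// div1r; exact: truncnS_gt.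
have m0 : (0 < m)%N.
  rewrite lt0n; apply: contraTneq m1s => ->; rewrite -leNgt; lra.
have m8 : (8 * s)^-1 <= m%:R.
  rewrite -div1r ler_pdivrMr ?mulr_gt0//.
  have : m.+1%:R <= 2 * m%:R :> R by rewrite -natrM ler_nat; lia.
  by move=> /(ler_wpM2r (ltW s40)); move: m1s; lra.
exists (m + m)%N; rewrite -(big_mkord xpredT (fun n => power_coef n * t ^+ n)).
rewrite (@big_cat_nat _ _ _ m) ?leq_addr//=.
rewrite ler_wpDl//; first by apply: sumr_ge0 => i _; rewrite mulr_ge0 ?power_coef_ge0 ?exprn_ge0.
have mR0 : 0 < m%:R :> R by rewrite ltr0n.
apply: (@le_trans _ _ (\sum_(m <= n < m + m) m%:R `^ g / (2 * m%:R) / 2)).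
  rewrite sumr_const_nat addnK -[leRHS]mulr_natr.
  have -> : m%:R `^ g / (2 * m%:R) / 2 * m%:R = m%:R `^ g / 4 by field; rewrite gt_eqF.
  rewrite ler_pM2r ?invr_gt0// ge0_ler_powR ?nnegrE ?invr_ge0 ?mulr_ge0 ?(ltW s0) ?(ltW g0)//.
apply: ler_sum_nat => n /andP[mn n2m]; have n0 : (0 < n)%N := leq_trans m0 mn.
have nR0 : 0 < n%:R :> R by rewrite ltr0n.
rewrite ler_pM ?divr_ge0 ?powR_ge0 ?mulr_ge0//.
  (* The sign of g - 1 is unknown, so numerator and denominator are estimated separately, by n >= m
     and n <= 2 m. *)
  have -> : power_coef n = n%:R `^ g / n%:R.
    by case: n n0 nR0 {mn n2m} => // n _ nR0; rewrite powR_split// mulrAC divff ?mul1r// gt_eqF.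
  rewrite ler_pM ?powR_ge0 ?invr_ge0 ?mulr_ge0//.
    by rewrite ge0_ler_powR ?nnegrE ?(ltW g0)// ler_nat.
  rewrite lef_pV2 ?posrE ?mulr_gt0// -natrM ler_nat; lia.
have := @bernoulli_le s n (ltW s0) s1; rewrite [1 - s]subKr; apply: le_trans.
have : n%:R * s <= 2 * m%:R * s by rewrite ler_pM2r// -natrM ler_nat; lia.
by move: ms; lra.
Qed.

End PowerSums.

(** * The weighted spaces: sufficiency, necessity and moments *)

Section WeightedSpaces.
Local Open Scope complex_scope.
Set Implicit Arguments. Unset Strict Implicit. Unset Printing Implicit Defensive.
Variables (R : realType) (mu : {finite_measure set R -> \bar R}) (g : R).
Hypothesis g0 : 0 < g.
Local Notation C := R[i].
Local Notation D := (`[0%R, 1%R[%classic : set R).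
Implicit Types (z h : C) (f : C -> C).
Let mD : measurable D := measurable_itv _.

Definition inv_weight (t : R) : R := ((1 - t) `^ g)^-1.
Local Notation G := inv_weight.

Lemma inv_weight_ge0 t : 0 <= G t.
Proof. by rewrite invr_ge0 powR_ge0. Qed.

Lemma inv_weight_measurable : measurable_fun D G.
Proof.
have : measurable_fun D ((fun x => x `^ (- g)) \o (fun t : R => 1 - t)).
  apply: measurableT_comp; first exact: measurable_powR.
  by apply: measurable_funB; [exact: measurable_cst|exact: measurable_id].
by apply: eq_measurable_fun => t _ /=; rewrite powRN.
Qed.

Lemma inv_weight_integrable :
  (\int[mu]_(t in D) (G t)%:E < +oo)%E <-> mu.-integrable D (EFin \o G).
Proof.
have absG : (\int[mu]_(t in D) `|(EFin \o G) t| = \int[mu]_(t in D) (G t)%:E)%E.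
  by apply: eq_integral => t _; rewrite /= ger0_norm// inv_weight_ge0.
split=> [fin|/integrableP[_]]; last by rewrite absG.
apply/integrableP; split; last by rewrite absG.
by apply/measurable_EFinP; exact: inv_weight_measurable.
Qed.

Lemma wnorm_le (v : C -> R) f (M : R) :
  (forall z, disc z -> v z * modc (f z) <= M) -> (wnorm v f <= M%:E)%E.
Proof. by move=> fM; apply: ge_ereal_sup => _ [z dz <-]; rewrite lee_fin fM. Qed.

Lemma le_wnorm (v : C -> R) f (M : R) z :
  (wnorm v f <= M%:E)%E -> disc z -> v z * modc (f z) <= M.
Proof.
move=> fM dz; rewrite -lee_fin; apply: le_trans fM.
by apply: ereal_sup_ubound; exists z.
Qed.

Lemma wnorm_bound (v : C -> R) f : (wnorm v f < +oo)%E ->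
  exists2 M : R, 0 <= M & (wnorm v f <= M%:E)%E.
Proof.
case: (wnorm v f) => [r _|//|_]; last by exists 0 => //; rewrite leNye.
by exists `|r| => //; rewrite lee_fin ler_norm.
Qed.

Lemma wnorm_dominated f (M : R) : holo f -> (wnorm (wgt g) f <= M%:E)%E ->
  dominated G f M.
Proof.
move=> hf fM; split=> [|t Dt]; first exact: holo_cont_disc.
have /le_wnorm/(_ (disc_real Dt)) := fM; move: Dt; rewrite /= in_itv /= => /andP[t0 t1].
by rewrite /wgt modc_real ger0_norm// mulrC -ler_pdivlMr// powR_gt0// subr_gt0.
Qed.

Lemma Hinf_dominated f : Hinf (wgt g) f -> exists2 M : R, 0 <= M & dominated G f M.
Proof.
by move=> [hf /wnorm_bound[M M0 fM]]; exists M => //; exact: wnorm_dominated.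
Qed.

Lemma wgt_le (a : R) z : 1 <= a -> disc z -> wgt a z <= 1 - modc z.
Proof.
move=> a1 dz; have z1 : 0 <= 1 - modc z by rewrite subr_ge0 ltW.
rewrite /wgt -mulr_powRB1// ?(lt_le_trans ltr01)//.
rewrite ler_piMr//; apply: (@le_trans _ _ (1 `^ (a - 1))); last by rewrite powR1.
have a10 : 0 <= a - 1 by rewrite subr_ge0.
have z1' : 1 - modc z <= 1 by rewrite gerBl modc_ge0.
by rewrite ge0_ler_powR ?nnegrE.
Qed.

Section Sufficiency.
Hypothesis iG : mu.-integrable D (EFin \o G).
Let G0 t (_ : D t) : 0 <= G t := inv_weight_ge0 t.
Local Notation I := (\int[mu]_(t in D) G t).
Local Notation bd := (bdry mu G).

Lemma bdry_ge0 r : 0 <= r -> r < 1 -> 0 <= bd r.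
Proof.
move=> r0 r1; apply: Rintegral_ge0 => t Dt; rewrite mulr_ge0 ?inv_weight_ge0//.
by have /andP[] := bdry_kernel_bounds r0 r1 Dt.
Qed.

(** Stated for any [f] with this decay, so that it applies both to transforms and to limits of
    transforms. *)
Lemma bdry_decay_H0 (a M : R) f : 1 <= a -> 0 <= M -> holo f ->
  (forall z, disc z -> (1 - modc z) * modc (f z) <= M * bd (modc z)) ->
  H0 (wgt a) f.
Proof.
move=> a1 M0 hf fM.
have wf z : disc z -> wgt a z * modc (f z) <= M * bd (modc z).
  by move=> dz; apply: le_trans (fM z dz); rewrite ler_wpM2r ?modc_ge0// wgt_le.
split; [split=> //|].
  apply: le_lt_trans (ltry (M * bd 0)); apply: wnorm_le => z dz.
  rewrite (le_trans (wf _ dz))// ler_wpM2l// bdry_nonincreasing ?modc_ge0//.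
move=> e e0; have M1 : 0 < M + 1 by rewrite ltr_wpDl.
have [r [r0 r1 rP]] := bdry_cvg0 iG G0 (divr_gt0 e0 M1).
exists r; split=> // z rz z1; apply: le_lt_trans (wf _ z1) _.
have := rP _ (ltW rz) z1; rewrite ler_pdivlMr// => be.
have b0 := bdry_ge0 (modc_ge0 z) z1.
(* The strict inequality M b < (M + 1) b fails for b = 0, so that case is separate. *)
have [b00|bpos] := eqVneq (bd (modc z)) 0; first by rewrite b00 mulr0.
apply: lt_le_trans be; rewrite mulrC ltr_pM2l ?ltrDl//.
by rewrite lt_neqAle eq_sym bpos.
Qed.

Lemma Imu_dominated_H0 (a M : R) f : 1 <= a -> 0 <= M -> dominated G f M ->
  H0 (wgt a) (Imu mu f).
Proof.
move=> a1 M0 fM; apply: (@bdry_decay_H0 a (2 * M)) => //; first by rewrite mulr_ge0.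
  exact: Imu_holo fM.
by move=> z dz; exact: Imu_bdry_le.
Qed.

Lemma Imu_maps_H0 (a : R) : 1 <= a -> Imu_maps mu (Hinf (wgt g)) (H0 (wgt a)).
Proof.
move=> a1 f /Hinf_dominated[M M0 fM]; split; first exact: dominated_Imu_def fM.
exact: Imu_dominated_H0 fM.
Qed.

(** [X] stays open so that one argument serves the domains [Hinf] and [H0]. *)
Lemma Imu_compact_H0 (a : R) (X : (C -> C) -> Prop) : 1 <= a ->
  (forall f, X f -> Hinf (wgt g) f) ->
  Imu_compact mu X (wgt g) (H0 (wgt a)) (wgt a).
Proof.
move=> a1 XH; split=> [f /XH|]; first exact: Imu_maps_H0.
move=> fs fsP; have fs1 k : dominated G (fs k) 1.
  by have [/XH[hf _] f1] := fsP k; exact: wnorm_dominated.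
have [k n|k z r N zr r1|phi [l [phi_incr Fl]]] := @bounded_coefficients_compact _
    (fun k => Imu mu (fs k)) (fun k n => Imu_coef mu (fs k) n) (2 * 1 * I).
- exact: Imu_coef_le.
- exact: Imu_approx.
have ptwise z : disc z -> mcvg (fun k => Imu mu (fs (phi k)) z) (l z).
  by move=> dz e e0; have [N NP] := Fl _ _ dz e0; exists N => k kN; exact: NP.
have lb z : disc z -> (1 - modc z) * modc (l z) <= 2 * 1 * bd (modc z).
  move=> dz; have z1 : 0 < 1 - modc z by rewrite subr_gt0.
  rewrite mulrC -ler_pdivlMr//; apply: (mcvg_modc_le (ptwise _ dz)).
  by exists 0%N => k _; rewrite ler_pdivlMr// mulrC; exact: Imu_bdry_le.
have hl : holo l.
  move=> z dz; pose s := (1 + modc z) / 2.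
  have [zs s1] : modc z < s /\ s < 1 by rewrite /s; move: dz; rewrite /disc/mkset; lra.
  have sz : 0 < s - modc z by rewrite subr_gt0.
  apply: (quad_diff_derivable sz).
  apply: (quad_diff_lim (F := fun k => Imu mu (fs (phi k))) sz).
    by move=> k; exact: Imu_quad_diff (fs1 _) zs s1.
  move=> h hs; apply: ptwise; apply: le_lt_trans s1.
  by rewrite (le_trans (modcD _ _))//; lra.
exists phi, l; split=> //; split; first exact: bdry_decay_H0 lb.
(* Near the circle the transform and the limit [l] are each bounded by twice [bd], hence the quarter
   of [e]. *)
move=> e e0; have [r [r0 r1 rP]] := bdry_cvg0 iG G0 (divr_gt0 e0 (ltr0n _ 4)).
have [N NP] := Fl _ _ r1 e0; exists N => k kN; apply: wnorm_le => z dz.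
have z1 : 0 <= 1 - modc z by rewrite subr_ge0 ltW.
apply: le_trans (ler_wpM2r (modc_ge0 _) (wgt_le a1 dz)) _.
have [zr|/ltW rz] := leP (modc z) r.
  rewrite (le_trans _ (NP _ kN _ zr))// ler_piMl ?modc_ge0//.
  by rewrite gerBl modc_ge0.
apply: le_trans (ler_wpM2l z1 (modcB _ _)) _; rewrite mulrDr.
have := rP _ rz dz; have := lb _ dz; have := Imu_bdry_le iG (fs1 (phi k)) dz.
lra.
Qed.

(** The function 1 / (1 - |z|) is continuous on [K], hence bounded there. *)
Lemma compact_sub_disc (K : set C^o) : compact K -> K `<=` @disc R ->
  exists2 r : R, r < 1 & forall z, K z -> modc z <= r.
Proof.
move=> cK Kd; pose q (z : C^o) : R := (1 - modc z)^-1.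
have cq : {within K, continuous q}.
  apply: continuous_in_subspaceT => z /set_mem/Kd dz.
  apply: (@continuousV R C^o (fun w => 1 - modc w) z); first by rewrite subr_eq0 eq_sym lt_eqF.
  apply: (@continuousB R R^o C^o (fun=> 1) (fun w => modc w) z).
    exact: cst_continuous.
  exact: continuous_modc.
have := compact_bounded (continuous_compact cq cK) => -[B [_ BP]].
(* Boundedness is available only for constants strictly above [B]; the maximum with 1 makes [b]
   invertible and positive. *)
pose b := Num.max 1 (B + 1); have b1 : 1 <= b by rewrite le_max lexx.
have b0 : 0 < b by exact: lt_le_trans b1.
exists (1 - b^-1); first by rewrite ltrBlDr ltrDl invr_gt0.
move=> z Kz; have z1 : 0 < 1 - modc z by rewrite subr_gt0; exact: Kd.
have : `|q z| <= b.
  by apply: BP; [rewrite lt_max ltrDl ltr01 orbT|exists z].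
rewrite ger0_norm ?invr_ge0 ?(ltW z1)// /q => zb.
have : b^-1 <= 1 - modc z by rewrite -[leRHS]invrK lef_pV2 ?posrE ?invr_gt0.
by lra.
Qed.

Lemma Imu_continuous : Imu_cont_HD mu (Hinf (wgt g)) (wgt g).
Proof.
split=> [f /Hinf_dominated[M M0 fM]|f Xf K cK Kd e e0].
  by split=> //; exact: dominated_Imu_def fM.
have [r r1 Kr] := compact_sub_disc cK Kd.
have I0 : 0 <= I by apply: Rintegral_ge0 => t _; exact: inv_weight_ge0.
have r1' : 0 < 1 - r by rewrite subr_gt0.
(* Makes 2 d I / (1 - r) smaller than [e]; [I + 1] because [I] may be 0. *)
pose d := e * (1 - r) / (2 * (I + 1)).
have I1 : 0 < 2 * (I + 1) by rewrite mulr_gt0// ltr_wpDl.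
have d0 : 0 < d by rewrite divr_gt0// mulr_gt0.
exists d; split=> // k Xk kf z Kz; have zr := Kr _ Kz.
have [Mf _ fM] := Hinf_dominated Xf; have [Mk _ kM] := Hinf_dominated Xk.
have dz : disc z := Kd _ Kz.
rewrite -(ImuB iG kM fM dz).
have kfd : dominated G (fun w => k w - f w) d.
  split=> [|t Dt]; first exact: (cont_discB kM.1 fM.1).
  have /le_wnorm/(_ (disc_real Dt)) := ltW kf; move: Dt; rewrite /= in_itv /= => /andP[t0 t1].
  by rewrite /wgt modc_real ger0_norm// mulrC -ler_pdivlMr// powR_gt0// subr_gt0.
apply: le_lt_trans (Imu_le iG kfd zr r1) _.
rewrite ltr_pdivrMr//; have -> : 2 * d * I = e * (1 - r) * (I / (I + 1)).
  by rewrite /d; field; rewrite gt_eqF// ltr_wpDl.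
by rewrite gtr_pMr ?mulr_gt0// ltr_pdivrMr ?mul1r ?ltrDl// ltr_wpDl.
Qed.

End Sufficiency.

(** At z = 0 the hypothesis says that Re f is integrable on [0,1), and for the test function Re f(t)
    >= a (1 - t)^(-g). *)
Lemma maps_inv_weight_integrable :
  Imu_maps mu (Hinf (wgt g)) (fun _ => True) -> mu.-integrable D (EFin \o G).
Proof.
move=> maps; have [b b0 bP] := power_sum_le g0; have [a a0 aP] := power_sum_ge g0.
have [f [hf fS]] := nonneg_power_series_holo (power_coef_ge0 g) (B := fun r => b * G r)
  (fun r N r0 r1 => bP r N r0 r1).
have Hf : Hinf (wgt g) f.
  split=> //; apply: le_lt_trans (ltry b); apply: wnorm_le => z dz.
  rewrite mulrC -ler_pdivlMr ?powR_gt0 ?subr_gt0//.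
  apply: (mcvg_modc_le (fS z dz)); exists 0%N => N _.
  apply: le_trans (modc_sum _ _ _) _; apply: le_trans (bP _ N (modc_ge0 z) dz).
  by apply: ler_sum => n _; rewrite modcM modcX modc_real ger0_norm ?power_coef_ge0.
have d0 : disc (0 : C) by rewrite /disc /mkset modc0.
have [[/(_ 0 d0)[iRe _] _] _] := maps _ Hf.
have le_Re t : D t -> a * G t <= complex.Re (f t%:C).
  move=> Dt; have := Dt; rewrite /= in_itv /= => /andP[t0 t1].
  (* The truncation rank [N] depends on t; nonnegative terms keep the lower bound for all later
     partial sums, hence for the limit. *)
  have [N NP] := aP t t0 t1; apply/ler_addgt0Pr => e e0.
  have [N' N'P] := fS _ (disc_real Dt) _ e0; pose n := maxn N N'.
  have := le_trans (Re_le_modc _) (N'P n (leq_maxr _ _)).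
  rewrite ReB ler_norml => /andP[_]; rewrite lerBlDr => /(le_trans _).
  rewrite addrC; apply; apply: le_trans NP _.
  have -> : \sum_(i < n) (power_coef g i)%:C * t%:C ^+ i =
      (\sum_(i < n) power_coef g i * t ^+ i)%:C.
    by rewrite rmorph_sum; apply: eq_bigr => i _; rewrite rmorphM rmorphXn.
  rewrite /= -!(big_mkord xpredT (fun i => power_coef g i * t ^+ i)).
  rewrite [leRHS](@big_cat_nat _ _ _ N) ?leq_maxl//= lerDl sumr_ge0// => i _.
  by rewrite mulr_ge0 ?power_coef_ge0 ?exprn_ge0.
have := integrableZl mD a^-1 iRe; apply: le_integrable => //.
  by apply/measurable_EFinP; exact: inv_weight_measurable.
move=> t Dt /=; rewrite lee_fin /Ikernel mulr0 subr0 divr1.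
rewrite ger0_norm ?inv_weight_ge0// (le_trans _ (ler_norm _))//.
by rewrite -ler_pdivrMl ?invr_gt0// invrK le_Re.
Qed.

Lemma integrable_exp n : mu.-integrable D (EFin \o (fun t => t ^+ n)).
Proof.
apply: (@le_integrable _ _ _ mu D mD _ (EFin \o cst 1)).
- by apply/measurable_EFinP; exact: measurable_funX.
- move=> t /unit_interval /andP[t0 t1] /=; rewrite lee_fin normr1.
  by rewrite ger0_norm ?exprn_ge0// exprn_ile1.
- exact: finite_measure_integrable_cst.
Qed.

Lemma moment_ge0 n : 0 <= moment mu n.
Proof.
apply: Rintegral_ge0 => t /unit_interval /andP[t0 _]; exact: exprn_ge0.
Qed.

(** Termwise integration of nonnegative terms. Index 0 is split off because the series of (iii)
    starts at 1. *)
Lemma integral_power_series :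
  (\int[mu]_(t in D) (\sum_(0 <= n <oo) (power_coef g n * t ^+ n)%:E) =
   (moment mu 0)%:E + \sum_(1 <= n <oo) (moment mu n * n%:R `^ (g - 1))%:E)%E.
Proof.
rewrite integral_nneseries//; last 2 first.
- move=> n; apply/measurable_EFinP; apply: measurable_funM.
    exact: measurable_cst.
  exact: measurable_funX.
- move=> n t /unit_interval /andP[t0 _].
  by rewrite lee_fin mulr_ge0 ?power_coef_ge0 ?exprn_ge0.
have coefE n : (\int[mu]_(t in D) (power_coef g n * t ^+ n)%:E =
    (power_coef g n * moment mu n)%:E)%E.
  under eq_integral do rewrite EFinM.
  rewrite integralZl//; last exact: integrable_exp.
  rewrite EFinM; congr (_ * _)%E; rewrite fineK//.
  exact: (integrable_fin_num mD (integrable_exp n)).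
under eq_eseriesr do rewrite coefE.
rewrite (nneseries_split 0 1); last first.
  by move=> n _; rewrite lee_fin mulr_ge0 ?power_coef_ge0 ?moment_ge0.
rewrite big_nat1 /= mul1r; congr (_ + _)%E.
by apply: congr_lim; apply/funext => N; apply: eq_big_nat => -[//|n] _; rewrite mulrC.
Qed.

(** The pointwise comparison is integrated over [0,1); the extra [moment mu 0] is a finite
    nonnegative number and does not affect convergence. *)
Lemma inv_weight_moments :
  (\int[mu]_(t in D) (G t)%:E < +oo)%E <->
  (\sum_(1 <= n <oo) (moment mu n * n%:R `^ (g - 1))%:E < +oo)%E.
Proof.
have [b b0 bP] := power_sum_le g0; have [a a0 aP] := power_sum_ge g0.
have term_ge0 t n : D t -> (0 <= (power_coef g n * t ^+ n)%:E)%E.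
  move=> /unit_interval /andP[t0 _].
  by rewrite lee_fin mulr_ge0 ?power_coef_ge0 ?exprn_ge0.
have mseries : measurable_fun D
    (fun t => \sum_(0 <= n <oo) (power_coef g n * t ^+ n)%:E)%E.
  apply: ge0_emeasurable_sum => // [n t Dt _|n _]; first exact: term_ge0.
  by apply/measurable_EFinP; apply: measurable_funM;
    [exact: measurable_cst|exact: measurable_funX].
have mcG c : measurable_fun D (fun t => (c * G t)%:E).
  apply/measurable_EFinP; apply: measurable_funM;
    [exact: measurable_cst|exact: inv_weight_measurable].
have cG_ge0 c t : 0 <= c -> (0 <= (c * G t)%:E)%E.
  by move=> c0; rewrite lee_fin mulr_ge0 ?inv_weight_ge0.
have intZ c : 0 <= c ->
    (\int[mu]_(t in D) (c * G t)%:E = c%:E * \int[mu]_(t in D) (G t)%:E)%E.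
  move=> c0; under eq_integral do rewrite EFinM.
  rewrite ge0_integralZl_EFin// => [t _|]; first by rewrite lee_fin inv_weight_ge0.
  by apply/measurable_EFinP; exact: inv_weight_measurable.
split=> fin.
  apply: (@le_lt_trans _ _ (\int[mu]_(t in D) (b * G t)%:E)%E).
    apply: le_trans (_ : (\int[mu]_(t in D)
      (\sum_(0 <= n <oo) (power_coef g n * t ^+ n)%:E) <= _)%E).
      by rewrite integral_power_series leeDr// lee_fin moment_ge0.
    apply: ge0_le_integral => // [t Dt|t Dt].
    - by apply: nneseries_ge0 => n _ _; exact: term_ge0.
    - apply: lime_le; first by apply: is_cvg_nneseries => n _ _; exact: term_ge0.
      apply: nearW => N; rewrite sumEFin lee_fin big_mkord.
      by move: Dt; rewrite /= in_itv /= => /andP[t0 t1]; exact: bP.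
  by rewrite intZ ?(ltW b0)// lte_mul_pinfty// lee_fin ltW.
have : (a%:E * \int[mu]_(t in D) (G t)%:E < +oo)%E.
  rewrite -intZ ?(ltW a0)//.
  apply: (@le_lt_trans _ _ (\int[mu]_(t in D)
      (\sum_(0 <= n <oo) (power_coef g n * t ^+ n)%:E))%E); last first.
    by rewrite integral_power_series lte_add_pinfty// ltry.
  apply: ge0_le_integral => // [t Dt|t Dt].
  - by apply: cG_ge0; exact: ltW.
  - have := Dt; rewrite /= in_itv /= => /andP[t0 t1]; have [N NP] := aP t t0 t1.
    apply: le_trans (nneseries_lim_ge N _); last by move=> n _ _; exact: term_ge0.
    by rewrite sumEFin lee_fin big_mkord.
(* An infinite integral would stay infinite after multiplication by the positive [a]. *)
case: (integral _ _ _) => [r _|/=|//]; first by rewrite ltry.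
by rewrite mulry gtr0_sg// mul1e.
Qed.

End WeightedSpaces.

(** * Assembly of the equivalences *)

Lemma Imu_compact_weaken (R : realType) (mu : {finite_measure set R -> \bar R})
    (X Y Y' : (R[i] -> R[i]) -> Prop) (v w : R[i] -> R) :
  (forall f, Y f -> Y' f) -> Imu_compact mu X v Y w -> Imu_compact mu X v Y' w.
Proof.
move=> YY' [maps cpt]; split=> [f /maps[? /YY']//|fs /cpt[phi [l [phiP [Yl lim]]]]].
by exists phi, l; split=> //; split=> //; exact: YY'.
Qed.

Theorem theorem18 (R : realType) (mu : {finite_measure set R -> \bar R}) (gamma : R)
  (hmu : mu (~` `[0%R, 1%R[) = 0%E) (hgamma : 0 < gamma) :
  let Wi := Imu_maps mu (Hinf (wgt gamma)) (fun _ => True) in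
  let Wic := Imu_cont_HD mu (Hinf (wgt gamma)) (wgt gamma) in
  let Wii := (\int[mu]_(t in `[0%R, 1%R[) (((1 - t) `^ gamma)^-1)%:E < +oo)%E in
  let Wiii := (\sum_(1 <= n <oo) (moment mu n * n%:R `^ (gamma - 1))%:E < +oo)%E in
  let Wiv := Imu_compact mu (Hinf (wgt gamma)) (wgt gamma) (Hinf (wgt 1)) (wgt 1) in
  let Wiv' := forall delta : R, 1 <= gamma + delta ->
      Imu_compact mu (Hinf (wgt gamma)) (wgt gamma)
        (Hinf (wgt (gamma + delta))) (wgt (gamma + delta)) in
  let Wv := Imu_maps mu (Hinf (wgt gamma)) (Hinf (wgt 1)) in
  let Wv' := forall delta : R, 1 <= gamma + delta ->
      Imu_maps mu (Hinf (wgt gamma)) (Hinf (wgt (gamma + delta))) in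
  ((Wi <-> Wic) /\ (Wi <-> Wii) /\ (Wi <-> Wiii) /\ (Wi <-> Wiv) /\
   (Wi <-> Wiv') /\ (Wi <-> Wv) /\ (Wi <-> Wv')) /\
  ((Imu_maps mu (Hinf (wgt 1)) (Hinf (wgt 1)) <->
      Imu_compact mu (Hinf (wgt 1)) (wgt 1) (Hinf (wgt 1)) (wgt 1)) /\
   (Imu_maps mu (Hinf (wgt 1)) (Hinf (wgt 1)) <->
      (\sum_(1 <= n <oo) (moment mu n)%:E < +oo)%E)) /\
  (Wi ->
     Imu_compact mu (H0 (wgt gamma)) (wgt gamma) (H0 (wgt 1)) (wgt 1) /\
     (forall delta : R, 1 <= gamma + delta ->
        Imu_compact mu (H0 (wgt gamma)) (wgt gamma)
          (H0 (wgt (gamma + delta))) (wgt (gamma + delta))) /\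
     Imu_maps mu (Hinf (wgt gamma)) (H0 (wgt 1))).
Proof.
have maps_weaken (g : R) (Y : (R[i] -> R[i]) -> Prop) :
    Imu_maps mu (Hinf (wgt g)) Y -> Imu_maps mu (Hinf (wgt g)) (fun _ => True).
  by move=> maps f /maps[].
have H0_Hinf (a : R) f : H0 (wgt a) f -> Hinf (wgt a) f by case.
have i_integrable (g : R) : 0 < g -> Imu_maps mu (Hinf (wgt g)) (fun _ => True) ->
    mu.-integrable `[0%R, 1%R[ (EFin \o inv_weight g).
  by move=> g0; exact: maps_inv_weight_integrable.
(* Condition (i) is the hub: it yields the strongest conclusion, compactness, and each mapping
   statement returns to it by forgetting the target. *)
have cpt (g a : R) : 0 < g -> 1 <= a -> Imu_maps mu (Hinf (wgt g)) (fun _ => True) ->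
    Imu_compact mu (Hinf (wgt g)) (wgt g) (Hinf (wgt a)) (wgt a).
  move=> g0 a1 /(i_integrable _ g0) iG; apply: Imu_compact_weaken (H0_Hinf a) _.
  exact: Imu_compact_H0.
have series (g : R) : 0 < g -> Imu_maps mu (Hinf (wgt g)) (fun _ => True) <->
    (\sum_(1 <= n <oo) (moment mu n * n%:R `^ (g - 1))%:E < +oo)%E.
  move=> g0; split=> [/(i_integrable _ g0)/inv_weight_integrable/inv_weight_moments|].
    exact.
  move=> /(inv_weight_moments mu g0)/inv_weight_integrable iG.
  exact: maps_weaken (Imu_maps_H0 iG (lexx 1)).
(* The choice delta = 1 is always admissible, so the statements over all delta give back (i). *)
have gamma1 : 1 <= gamma + 1 by rewrite lerDr ltW.
split; [|split].
- split.
    split=> [/(i_integrable _ hgamma) iG|[]//]; exact: Imu_continuous.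
  split.
    split=> [/(i_integrable _ hgamma)/inv_weight_integrable//|/inv_weight_integrable iG].
    exact: maps_weaken (Imu_maps_H0 iG (lexx 1)).
  split; first exact: series.
  split; first by split=> [|[/maps_weaken]//]; exact: cpt.
  split.
    by split=> [Wi d d1|/(_ 1 gamma1)[/maps_weaken]//]; exact: cpt.
  split.
    by split=> [/(cpt _ _ hgamma (lexx 1))[]|/maps_weaken].
  by split=> [Wi d d1|/(_ 1 gamma1)/maps_weaken//]; case: (cpt _ _ hgamma d1 Wi).
- split.
    by split=> [/maps_weaken/(cpt _ _ ltr01 (lexx 1))|[]].
  (* For exponent 1 the factor n^(g-1) is a zeroth power, equal to 1. *)
  have <- : (\sum_(1 <= n <oo) (moment mu n * n%:R `^ (1 - 1))%:E =
             \sum_(1 <= n <oo) (moment mu n)%:E)%E.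
    by apply: eq_eseriesr => n _; rewrite subrr powRr0 mulr1.
  rewrite -series//; split=> [/maps_weaken//|/(cpt _ _ ltr01 (lexx 1))[]//].
- move=> /(i_integrable _ hgamma) iG; split; last split.
  + by apply: Imu_compact_H0 => // f; exact: H0_Hinf.
  + by move=> d d1; apply: Imu_compact_H0 => // f; exact: H0_Hinf.
  + exact: Imu_maps_H0.
Qed.
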